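(* Let $K$ be an algebraically closed field of arbitrary characteristic, let $1\le d<n$, $G=SL_n(K)$, and let $P_d\subset G$ be the maximal parabolic subgroup with $G/P_d\cong G_{d,n}$ (the Grassmannian of $d$-dimensional subspaces of $K^n$). Let $w\in W/W_{P_d}$, and let $X(w)\subset G/P_d$ be the corresponding Schubert variety. Then the Hilbert function of the tangent cone to $X(w)$ at the identity point is given by $$h_{\mathrm{TC}_{id}X(w)}(m)=|S_w(m)|,\qquad m\in\mathbb{N}.$$
   Context: Setup. $T\subset G$ is the subgroup of diagonal matrices, $B\subset G$ the subgroup of upper triangular matrices, $W=S_n$ the Weyl group, and $P_d$ the subgroup of matrices in $G$ whose lower-left $(n-d)\times d$ block is zero. $W_{P_d}=S_d\times S_{n-d}$ is the Weyl group of $P_d$. $R^+$ and $R_{P_d}^+$ are the sets of positive roots of $G$ and $P_d$ (relative to $T$ and $B$), so $R^+\setminus R_{P_d}^+=\{\epsilon_j-\epsilon_i : 1\le j\le d,\ d+1\le i\le n\}$; for $\alpha=\epsilon_j-\epsilon_i$, $s_\alpha=s_{(i,j)}$ is the transposition exchanging $i$ and $j$. Bruhat order. $W/W_{P_d}$ is identified with $I_{d,n}=\{(i_1,\dots,i_d): 1\le i_1<\dots<i_d\le n\}$ by sending the coset of $\sigma$ to the increasing rearrangement of $\sigma(1),\dots,\sigma(d)$. The (Bruhat) order is $\underline i\ge\underline j$ iff $i_t\ge j_t$ for all $1\le t\le d$. The map $\alpha\mapsto s_\alpha W_{P_d}$ embeds $R^+\setminus R_{P_d}^+$ into $W/W_{P_d}$;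 reflections $s_\alpha$ ($\alpha\in R^+\setminus R^+_{P_d}$) are compared through this embedding, and a product of reflections is compared to $w$ through its coset in $W/W_{P_d}$. Schubert varieties. With $e_1,\dots,e_n$ the standard basis of $K^n$ and $G_{d,n}\subset\mathbb{P}(\wedge^dK^n)$ via the Plücker embedding, $X(w)$ for $w=(i_1,\dots,i_d)$ is the Zariski closure of the $B$-orbit of $[e_{i_1}\wedge\dots\wedge e_{i_d}]$, with reduced structure. The identity point $id$ is $[e_1\wedge\dots\wedge e_d]$. Multisets. A multiset is a set with repetitions allowed; its cardinality $|S|$ counts repetitions. For a set $\mathcal S$, $\mathcal S^*$ is the collection of all multisets made up of elements of $\mathcal S$. A chain of commuting reflections is a nonempty set of pairwise-commuting reflections $\{s_{\alpha_1},\dots,s_{\alpha_t}\}$, $\alpha_i\in R^+\setminus R_{P_d}^+$, such that $s_{\alpha_1}>\dots>s_{\alpha_t}$ in the Bruhat order on $W/W_{P_d}$; it is a chain in a multiset $S\in(R^+\setminus R_{P_d}^+)^*$ if all $\alpha_i$ occur in $S$. $S_w$ is the set of multisets $S\in(R^+\setminus R_{P_d}^+)^*$ such that the product $s_{\alpha_1}\cdots s_{\alpha_t}$ of every chain of commuting reflections in $S$ is $\le w$. $S_w(m)=\{S\in S_w: |S|=m\}$. Tangent cone. For a point $P$ of a variety $X$ with local ring $A=\mathcal O_{X,P}$ and maximal ideal $\mathfrak m$, $\mathrm{TC}_P(X)=\mathrm{Spec}(\mathrm{gr}(A,\mathfrak m))$, where $\mathrm{gr}(A,\mathfrak m)=\bigoplus_{j\ge0}\mathfrak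 m^j/\mathfrak m^{j+1}$. Its Hilbert function is $h_{\mathrm{TC}_PX}(m)=\dim_K(\mathfrak m^m/\mathfrak m^{m+1})$. *)

(* Defs.v *)
From HB Require Import structures.
From mathcomp Require Import all_boot all_order all_fingroup all_algebra.
From mathcomp Require Import generic_quotient ring_quotient fraction.
From mathcomp Require Import finmap multiset.
From mathcomp Require Import boolp.
From mathcomp.multinomials Require Import mpoly.

Set Implicit Arguments.
Unset Strict Implicit.
Unset Printing Implicit Defensive.

Import GRing.Theory.
Local Open Scope ring_scope.
Local Open Scope quotient_scope.

Section Algebra.

(* The [k]-th power of the ideal generated by [I]; it is the whole ring when
   [k = 0]. *)
Definition ideal_pow (R : comPzRingType) (I : R -> Prop) (k : nat) (x : R) : Prop :=
  exists (r : nat) (c : 'I_r -> R) (f : 'I_r -> 'I_k -> R),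
    (forall i j, I (f i j)) /\ x = \sum_(i < r) c i * \prod_(j < k) f i j.

(* [dim_K U / U' = k]: some [e_0, ..., e_(k-1)] in [U] form a basis modulo
   [U'].  Only used for subspaces [U' <= U]. *)
Definition quot_dim (K : fieldType) (V : lmodType K) (U U' : V -> Prop) (k : nat) : Prop :=
  exists e : 'I_k -> V,
    (forall i, U (e i)) /\
    (forall v, U v -> exists! c : 'rV[K]_k, U' (v - \sum_i c 0 i *: e i)).

End Algebra.

Local Notation "x %:F" := (FracField.tofrac x).

Lemma tofrac_divB (R : idomainType) (a b c d : R) : b != 0 -> d != 0 ->
  a%:F / b%:F - c%:F / d%:F = (a * d - c * b)%:F / (b * d)%:F.
Proof.
move=> b0 d0; rewrite tofracB !tofracM -mulNr.
by rewrite addf_div ?tofrac_eq0 // mulNr.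
Qed.

Lemma tofrac_divM (R : idomainType) (a b c d : R) :
  (a%:F / b%:F) * (c%:F / d%:F) = (a * c)%:F / (b * d)%:F.
Proof. by rewrite mulf_div !tofracM. Qed.

Lemma tofrac_div1 (R : idomainType) (a : R) : a%:F / 1%:F = a%:F.
Proof. by rewrite tofrac1 divr1. Qed.

(* A point of the projective space [P^(N-1)] is given by a nonzero row of
   homogeneous coordinates, and a subset [X] of it by its cone of such rows. *)
Section ProjectiveSpace.
Variables (K : closedFieldType) (N : nat).
Implicit Types (X : 'rV[K]_N -> Prop) (P v : 'rV[K]_N) (f g : {mpoly K[N]}).

Definition zariski_closure X : 'rV[K]_N -> Prop := fun v =>
  v != 0 /\
  forall k f, f \is k.-homog -> (forall u, X u -> f.@[u 0] = 0) -> f.@[v 0] = 0.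

(* Fractions [f / g] of forms of equal degree with [g(P) != 0]: the local ring
   of [P^(N-1)] at [P], inside the field of fractions. *)
Definition regular_at P : pred {fraction {mpoly K[N]}} := fun x =>
  `[< exists k f g, [/\ f \is k.-homog, g \is k.-homog, g.@[P 0] != 0
                      & x = f%:F / g%:F] >].

Lemma meval_neq0 P g : g.@[P 0] != 0 -> g != 0.
Proof. by apply: contraNneq => ->; rewrite meval0. Qed.

Lemma regular_at_subring P : subring_closed (regular_at P).
Proof.
split.
- apply/asboolP; exists 0%N, 1, 1; split; rewrite ?dhomog1 ?meval1 ?oner_neq0 //.
  by rewrite tofrac_div1 tofrac1.
- move=> x y /asboolP[k [f [g [hf hg g0 ->]]]] /asboolP[l [f' [g' [hf' hg' g'0 ->]]]].
  apply/asboolP; exists (k + l)%N, (f * g' - f' * g), (g * g'); split.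
  + by apply: rpredB; [exact: dhomogM | rewrite addnC; exact: dhomogM].
  + exact: dhomogM.
  + by rewrite mevalM mulf_neq0.
  + exact: tofrac_divB (meval_neq0 g0) (meval_neq0 g'0).
- move=> x y /asboolP[k [f [g [hf hg g0 ->]]]] /asboolP[l [f' [g' [hf' hg' g'0 ->]]]].
  apply/asboolP; exists (k + l)%N, (f * f'), (g * g'); split; try exact: dhomogM.
  + by rewrite mevalM mulf_neq0.
  + exact: tofrac_divM.
Qed.

HB.instance Definition _ P :=
  GRing.isSubringClosed.Build _ (regular_at P) (regular_at_subring P).

Definition proj_local_ring P := {x : {fraction {mpoly K[N]}} | regular_at P x}.
HB.instance Definition _ P := SubChoice.on (proj_local_ring P).
HB.instance Definition _ P :=
  [SubChoice_isSubComNzRing of proj_local_ring P by <:].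

(* The stalk at [P] of the ideal sheaf of all functions vanishing on [X]. *)
Definition local_ideal X P (x : proj_local_ring P) : bool :=
  `[< exists k f g, [/\ f \is k.-homog, g \is k.-homog, g.@[P 0] != 0,
                        forall u, X u -> f.@[u 0] = 0
                      & val x = f%:F / g%:F] >].

Arguments local_ideal : clear implicits.

Lemma local_ideal_zmod X P : zmod_closed (local_ideal X P).
Proof.
split.
- apply/asboolP; exists 0%N, 0, 1; split; rewrite ?dhomog1 ?rpred0 ?meval1 ?oner_neq0 //.
  + by move=> u _; rewrite meval0.
  + by rewrite tofrac_div1 tofrac0.
- move=> x y /asboolP[k [f [g [hf hg g0 fX ex]]]] /asboolP[l [f' [g' [hf' hg' g'0 f'X ey]]]].
  apply/asboolP; exists (k + l)%N, (f * g' - f' * g), (g * g'); split.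
  + by apply: rpredB; [exact: dhomogM | rewrite addnC; exact: dhomogM].
  + exact: dhomogM.
  + by rewrite mevalM mulf_neq0.
  + by move=> u Xu; rewrite mevalB !mevalM fX // f'X // !mul0r subrr.
  + have -> : val (x - y) = val x - val y by [].
    by rewrite ex ey; exact: tofrac_divB (meval_neq0 g0) (meval_neq0 g'0).
Qed.

Lemma local_idealMl X P (a x : proj_local_ring P) :
  x \in local_ideal X P -> a * x \in local_ideal X P.
Proof.
move=> /asboolP[k [f [g [hf hg g0 fX ex]]]].
have /asboolP[l [f' [g' [hf' hg' g'0 ea]]]] := valP a.
apply/asboolP; exists (l + k)%N, (f' * f), (g' * g); split; try exact: dhomogM.
- by rewrite mevalM mulf_neq0.
- by move=> u Xu; rewrite mevalM fX // mulr0.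
- have -> : val (a * x) = val a * val x by [].
  by rewrite ex ea; exact: tofrac_divM.
Qed.

HB.instance Definition _ X P :=
  GRing.isZmodClosed.Build _ (local_ideal X P) (local_ideal_zmod X P).
Definition local_ideal_zmodClosed X P : zmodClosed (proj_local_ring P) :=
  GRing.ZmodClosed.clone (proj_local_ring P) (local_ideal X P) _.

(* The local ring at [P] of [X] with its reduced structure.  It is the zero
   ring when [P] is not in the closure of [X], hence only a [comPzRingType]. *)
Definition local_ring X P := Quotient.quot (local_ideal_zmodClosed X P).
HB.instance Definition _ X P := Choice.on (local_ring X P).
HB.instance Definition _ X P := GRing.Zmodule.on (local_ring X P).
HB.instance Definition _ X P := EqQuotient.on (local_ring X P).

Section LocalRing.
Variables (X : 'rV[K]_N -> Prop) (P : 'rV[K]_N).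
Local Notation A := (local_ring X P).
Local Notation J := (local_ideal_zmodClosed X P).

Definition lr_one : A := \pi_A 1.
Definition lr_mul : A -> A -> A := lift_op2 A *%R.

Lemma lr_pi_mul : {morph \pi_A : x y / x * y >-> lr_mul x y}.
Proof.
move=> x y; unlock lr_mul; apply/eqP; rewrite piE Quotient.equivE.
have -> : x * y - repr (\pi_A x) * repr (\pi_A y)
   = y * (x - repr (\pi_A x)) + repr (\pi_A x) * (y - repr (\pi_A y)).
  by rewrite !mulrBr addrA [y * x]mulrC [y * repr _]mulrC subrK.
by rewrite rpredD ?local_idealMl // Quotient.idealrBE reprK.
Qed.

Lemma lr_mulA : associative lr_mul.
Proof.
by move=> x y z; rewrite -[x]reprK -[y]reprK -[z]reprK -!lr_pi_mul mulrA.
Qed.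
Lemma lr_mulC : commutative lr_mul.
Proof. by move=> x y; rewrite -[x]reprK -[y]reprK -!lr_pi_mul mulrC. Qed.
Lemma lr_mul1 : left_id lr_one lr_mul.
Proof. by move=> x; rewrite -[x]reprK /lr_one -lr_pi_mul mul1r. Qed.
Lemma lr_piD : {morph \pi_A : x y / x + y >-> x + y}.
Proof. exact: (@Quotient.pi_add _ J). Qed.
Lemma lr_mulD : left_distributive lr_mul +%R.
Proof.
move=> x y z; rewrite -[x]reprK -[y]reprK -[z]reprK.
by rewrite -lr_piD -!lr_pi_mul mulrDl lr_piD.
Qed.

HB.instance Definition _ :=
  GRing.Zmodule_isComPzRing.Build A lr_mulA lr_mulC lr_mul1 lr_mulD.

Lemma proj_const_subproof (c : K) : regular_at P (c%:MP%:F).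
Proof.
apply/asboolP; exists 0%N, c%:MP, 1; split; rewrite ?dhomog1 ?meval1 ?oner_neq0 //.
- by rewrite -[X in X \is _]mulr1 mul_mpolyC; apply: dhomogZ; exact: dhomog1.
- by rewrite tofrac_div1.
Qed.
Definition proj_const (c : K) : proj_local_ring P :=
  exist _ (c%:MP%:F) (proj_const_subproof c).

Definition lr_scale (c : K) (x : A) : A := \pi_A (proj_const c) * x.

Lemma lr_scaleA a b x : lr_scale a (lr_scale b x) = lr_scale (a * b) x.
Proof.
rewrite /lr_scale mulrA -[_ * \pi_A _]lr_pi_mul; congr (\pi_A _ * _).
by apply: val_inj => /=; rewrite mpolyCM tofracM.
Qed.
Lemma lr_scale1 : left_id 1 lr_scale.
Proof.
move=> x; rewrite /lr_scale -[RHS]mul1r; congr (\pi_A _ * _).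
by apply: val_inj => /=; rewrite mpolyC1 tofrac1.
Qed.
Lemma lr_scaleDr : right_distributive lr_scale +%R.
Proof. by move=> c x y; rewrite /lr_scale mulrDr. Qed.
Lemma lr_scaleDl x : {morph lr_scale^~ x : a b / a + b}.
Proof.
move=> a b; rewrite /lr_scale -mulrDl -lr_piD; congr (\pi_A _ * _).
by apply: val_inj => /=; rewrite mpolyCD tofracD.
Qed.

HB.instance Definition _ :=
  GRing.Zmodule_isLmodule.Build K A lr_scaleA lr_scale1 lr_scaleDr lr_scaleDl.

Definition max_ideal (x : A) : Prop :=
  exists y : proj_local_ring P, x = \pi_A y /\
    exists k f g, [/\ f \is k.-homog, g \is k.-homog, g.@[P 0] != 0,
                      f.@[P 0] = 0 & val y = f%:F / g%:F].

(* [h] is the value at [m] of the Hilbert function of the tangent cone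
   [Spec gr(A, max_ideal)]. *)
Definition hilbert_tangent_cone (m h : nat) : Prop :=
  quot_dim (ideal_pow max_ideal m) (ideal_pow max_ideal m.+1) h.

End LocalRing.
End ProjectiveSpace.

(* Indices are shifted by one: [1, ..., n] is ['I_n = {0, ..., n-1}]. *)
Section Combinatorics.
Variables (n d : nat).

Definition Idn := {t : d.-tuple 'I_n | sorted (fun i j : 'I_n => (i < j)%N) t}.

Definition bruhat_le (i j : Idn) : bool :=
  [forall t : 'I_d, (tnth (val i) t <= tnth (val j) t)%N].
Definition bruhat_lt (i j : Idn) : bool := (i != j) && bruhat_le i j.

Variable le_dn : (d <= n)%N.

Definition coset_tuple (s : 'S_n) : d.-tuple 'I_n :=
  [tuple of sort (fun i j : 'I_n => (i <= j)%N)
                 [tuple s (widen_ord le_dn t) | t < d]].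

Lemma coset_tuple_sorted s :
  sorted (fun i j : 'I_n => (i < j)%N) (coset_tuple s).
Proof.
have : sorted (fun i j : 'I_n => (i <= j)%N) (coset_tuple s).
  by apply: sort_sorted => i j; exact: leq_total.
have : uniq (coset_tuple s).
  rewrite sort_uniq map_inj_uniq ?enum_uniq // => i j /perm_inj /(congr1 val) /=.
  exact: val_inj.
rewrite -(map_inj_uniq val_inj) => us.
rewrite -[sorted _ _]/(sorted (relpre val leq) _) -sorted_map => ls.
rewrite -[sorted _ _]/(sorted (relpre val ltn) _) -sorted_map.
by rewrite ltn_sorted_uniq_leq us.
Qed.

(* The class of [s] in [W / W_(P_d)]. *)
Definition coset_Idn (s : 'S_n) : Idn :=
  exist _ (coset_tuple s) (coset_tuple_sorted s).

(* The pair [(j, i)] is the root [eps_j - eps_i] of [R^+ \ R_(P_d)^+]. *)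
Definition proot := {a : 'I_n * 'I_n | (a.1 < d <= a.2)%N}.

Definition refl_of (a : proot) : 'S_n := tperm (val a).1 (val a).2.

(* The list [c] enumerates the chain in decreasing order.  Its members commute,
   so the order of composition in the product of [in_Sw] is immaterial. *)
Definition commuting_chain (c : seq proot) : Prop :=
  [/\ c != [::],
      {in c &, forall a b, commute (refl_of a) (refl_of b)}
    & sorted (fun a b => bruhat_lt (coset_Idn (refl_of b))
                                   (coset_Idn (refl_of a))) c].

Definition in_Sw (w : Idn) (S : multiset proot) : Prop :=
  forall c, commuting_chain c -> {subset c <= S} ->
    bruhat_le (coset_Idn (\prod_(a <- c) refl_of a)%g) w.

(* All multisets of cardinality [m] are of the form [seq_mset t]; see [SwP]. *)
Definition Sw (w : Idn) (m : nat) : {fset multiset proot} :=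
  [fset S in [seq seq_mset (tval t) | t : m.-tuple proot]
     | `[< in_Sw w S >]]%fset.

Lemma SwP w m (S : multiset proot) :
  S \in Sw w m <-> in_Sw w S /\ size S = m.
Proof.
rewrite !inE /=; split.
- case/andP => /imageP[t _ ->] /asboolP h; split=> //.
  by rewrite (perm_size (perm_eq_seq_mset t)) size_tuple.
- case=> h sS; apply/andP; split; last exact/asboolP.
  apply/imageP; exists (@Tuple m _ (S : seq proot) (introT eqP sS)) => //.
  apply/msetP => a; rewrite mset_seqE /=.
  exact/esym/count_mem_mset.
Qed.

End Combinatorics.

Section Schubert.
Variables (K : closedFieldType) (n d : nat).
Local Notation N := #|{: Idn n d}|.

(* Coordinates of the exterior product of the columns of [M] in the basis
   [e_(i_1) /\ ... /\ e_(i_d)] of the [d]-th exterior power of [K^n]. *)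
Definition wedge (M : 'M[K]_(n, d)) : 'rV[K]_N :=
  \row_a \det (\matrix_(s < d, t < d) M (tnth (val (enum_val a)) s) t).

Definition basis_mx (w : Idn n d) : 'M[K]_(n, d) :=
  \matrix_(i, t) (i == tnth (val w) t)%:R.

Definition borel (b : 'M[K]_n) : Prop :=
  \det b = 1 /\ forall i j : 'I_n, (j < i)%N -> b i j = 0.

Definition borel_orbit (w : Idn n d) : 'rV[K]_N -> Prop := fun v =>
  exists b c, [/\ borel b, c != 0 & v = c *: wedge (b *m basis_mx w)].

Definition schubert (w : Idn n d) (v : 'rV[K]_N) : Prop :=
  zariski_closure (borel_orbit w) v.

Definition id_point (le_dn : (d <= n)%N) : 'rV[K]_N :=
  wedge (basis_mx (coset_Idn le_dn 1%g)).

End Schubert.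

Arguments schubert K {n d} w v.

(* Main.v *)
Require Import Defs.
From HB Require Import structures.
From mathcomp Require Import all_boot all_order all_fingroup all_algebra.
From mathcomp Require Import generic_quotient ring_quotient fraction.
From mathcomp Require Import zify ring.
From mathcomp Require Import finmap multiset boolp.
From mathcomp.multinomials Require Import mpoly.

Set Implicit Arguments.
Unset Strict Implicit.
Unset Printing Implicit Defensive.
Import GRing.Theory.
Local Open Scope ring_scope.
Local Open Scope quotient_scope.

(** Near the identity point the Grassmannian is an affine space of matrices: a
    point is spanned by the columns of an n x d matrix [1; X] with identity top
    block, with one free coordinate x_b for every box b = (j, i), j < d <= i,
    that is, for every root of R^+ minus R_P^+.  A chain of commuting
    reflections is a sequence of boxes whose columns j increase and whose rows i
    decrease strictly, so it indexes the main diagonal of a minor of X.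

    For a threshold q let R_q be the rectangle of boxes with j < q <= i.
    Counting entries below q in the coset of a product of commuting reflections
    turns the Bruhat inequality into: a multiset S lies in S_w iff, for every q,
    no chain of S inside R_q is longer than
       r_q = #{t < d : t < q} - #{t < d : w_t < q}
    ([in_Sw_admissible]).  On the B-orbit of w the block of X supported on R_q
    has rank r_q, so the forbidden chains are diagonals of minors that vanish on
    X(w) ([chain_minor_eq0]).

    The theorem says that the monomials x^S, S in S_w(m), form a basis of
    M^m / M^(m+1), where M is the maximal ideal of the local ring.

    They span.  All Pluecker coordinates are minors of [1; X], so the local ring
    is K + span(x_b) + M^2, and M^m is spanned by the monomials of degree m
    modulo M^(m+1) ([span_ideal_pow]).  If a monomial contains a forbidden
    chain, the vanishing minor rewrites it through the other terms of the
    Leibniz expansion, and these have smaller weight by the rearrangement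
    inequality ([straighten]).

    They are independent.  X(w) contains, with [1; X], the whole line [1; t X].
    A combination of monomials of degree m that lies in M^(m+1) vanishes to
    order m+1 at t = 0 on each such line, hence vanishes at X
    ([leading_form_eq0]).  It remains to see that no nontrivial combination of
    admissible monomials vanishes on the whole cell ([monomials_independent]).
    This is a degeneration argument, by induction on Young diagrams.  More
    generally than at the identity, one works on the slice through the
    coordinate subspace of a Grassmannian permutation v that is transversal to
    its B-orbit, the chart of v; its coordinates are the boxes of a diagram.  Remove a corner box c, which replaces v by s v for a
    simple reflection s.  Taking the Schur complement with respect to x_c
    identifies the part x_c <> 0 of the cell of w in the chart of v with (the
    cell of w in the chart of s v) x K^*, so the leading coefficient in x_c of a
    function vanishing on the former vanishes on the cell of w in the chart of
    s v ([schur_point_in_cell]).  On the other hand a point of the cell of s w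
    in the chart of s v extends to a point of the cell of w in the chart of v
    ([fill_point_in_cell]), which handles functions that do not involve x_c.
    Admissible exponents follow these two moves: the three lemmas
    [admissible_shrink_stable], [admissible_shrink_link] and
    [admissible_shrink_swap]. *)

(** * Boxes, Young diagrams and chain conditions *)

Section Boxes.
Variables (n d : nat).
Implicit Types (v : 'S_n) (w : 'I_d -> 'I_n) (b c : proot n d).

Definition bcol b : 'I_n := (val b).1.
Definition brow b : 'I_n := (val b).2.
Local Notation row b := (brow b).
Local Notation col b := (bcol b).

Lemma box_bounds b : (col b < d)%N /\ (d <= row b)%N.
Proof. by have /andP[] := valP b. Qed.

Lemma box_eqE b b' : (b == b') = (col b == col b') && (row b == row b').
Proof. by rewrite -val_eqE /brow /bcol; case: (val b) (val b') => ? ? []. Qed.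

Lemma row_neq_col b b' : row b != col b'.
Proof.
by apply/eqP => e; have [_ +] := box_bounds b; have [+ _] := box_bounds b'; rewrite e; lia.
Qed.

Lemma perm_nat_eq v (x y : 'I_n) : (v x == v y :> nat) = (x == y).
Proof. by rewrite (inj_eq val_inj) (inj_eq perm_inj). Qed.

Definition box_lt b b' := ((col b < col b') && (row b' < row b))%N.

Lemma box_lt_trans : transitive box_lt.
Proof. by move=> a b c /andP[? ?] /andP[? ?]; apply/andP; split; lia. Qed.

End Boxes.

(** A permutation v stands for the coordinate subspace of v 0, ..., v (d-1), its
    pivots.  The boxes [in_shape v] are the coordinates on the slice through its
    point transversal to its B-orbit; they form the full rectangle for v = 1. *)
Section Shapes.
Variables (n d : nat) (le_dn : (d <= n)%N).
Implicit Types (v : 'S_n) (w : 'I_d -> 'I_n) (b c : proot n d).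
Local Notation W := (widen_ord le_dn).
Local Notation row b := (brow b).
Local Notation col b := (bcol b).

Definition count_below (f : 'I_d -> 'I_n) (q : nat) : nat := (\sum_(t < d) (f t < q))%N.

Definition in_rect v (q : nat) b := (v (col b) < q <= v (row b))%N.

Definition in_shape v b := (v (col b) < v (row b))%N.

(** [m] is the exponent of a monomial in the box coordinates.  The difference of
    the two counts is the rank that a matrix of the cell of w has on the
    rectangle; the empty chain is allowed, so an admissible exponent exists only
    if this difference is nonnegative for every q. *)
Definition admissible v w (m : proot n d -> nat) : Prop :=
  forall (q : nat) (C : seq (proot n d)), sorted (@box_lt n d) C ->
    all (fun b => (0 < m b)%N && in_rect v q b) C ->
    (size C + count_below w q <= count_below (v \o W) q)%N.

Definition grassmannian v :=
  forall i j : 'I_n, (i < j)%N -> (j < d)%N || (d <= i)%N -> (v i < v j)%N.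

Lemma count_belowS w q : injective w ->
  count_below w q.+1 = (count_below w q + [exists t, w t == q :> nat])%N.
Proof.
move=> w_inj.
have -> : [exists t, w t == q :> nat] = (\sum_(t < d) (w t == q :> nat))%N :> nat.
  case: existsP => [[t /eqP wt]|no].
    rewrite (bigD1 t) //= wt eqxx big1 // => t' ne.
    case: eqP => // e; case/negP: ne; apply/eqP/w_inj/val_inj => /=; congruence.
  rewrite big1 // => t _; case: eqP => // e; case: no; exists t; exact/eqP.
rewrite /count_below -big_split /=; apply: eq_bigr => t _; lia.
Qed.

Lemma colW c : exists t, W t = col c.
Proof.
have [h _] := box_bounds c; exists (Ordinal h); exact: val_inj.
Qed.

Lemma vW_inj v : injective (v \o W).
Proof. by move=> x y /= /perm_inj /(congr1 val) /= ?; exact: val_inj. Qed.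

(** A corner is a box whose row and column labels are adjacent for v; removing it
    from the diagram is multiplying v by the simple transposition of p and
    p + 1.  The rectangles of all thresholds other than p + 1 are unaffected,
    and the one of p + 1 loses its last row and column. *)
Section Corner.
Variables (v : 'S_n) (c : proot n d).
Hypothesis v_gr : grassmannian v.
Hypothesis corner : v (row c) = (v (col c)).+1 :> nat.
Local Notation p := (v (col c)).
Local Notation s := (tperm (v (col c)) (v (row c))).
Local Notation v' := (v * s)%g.

Lemma shrink_col : v' (col c) = v (row c).
Proof. by rewrite permM tpermL. Qed.
Lemma shrink_row : v' (row c) = v (col c).
Proof. by rewrite permM tpermR. Qed.
Lemma shrink_other x : x != col c -> x != row c -> v' x = v x.
Proof. by move=> x1 x2; rewrite permM tpermD // (inj_eq perm_inj) eq_sym. Qed.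

Lemma shrink_colE b : v' (col b) = if col b == col c then v (row c) else v (col b).
Proof.
case: eqP => [->|/eqP ne]; first exact: shrink_col.
by rewrite shrink_other // eq_sym row_neq_col.
Qed.
Lemma shrink_rowE b : v' (row b) = if row b == row c then v (col c) else v (row b).
Proof.
case: eqP => [->|/eqP ne]; first exact: shrink_row.
by rewrite shrink_other // row_neq_col.
Qed.

Lemma in_rect_shrink b q : q != p.+1 -> in_rect v' q b -> in_rect v q b.
Proof.
rewrite /in_rect shrink_colE shrink_rowE => qp.
by case: (col b =P col c) => [->|_]; case: (row b =P row c) => [->|_]; lia.
Qed.

Lemma in_rect_corner b : in_rect v' p.+1 b -> (v (col b) < p)%N && (p.+1 < v (row b))%N.
Proof.
rewrite /in_rect shrink_colE shrink_rowE.
have := perm_nat_eq v (col b) (col c); have := perm_nat_eq v (row b) (row c).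
by case: (col b =P col c) => e1; case: (row b =P row c) => e2; lia.
Qed.

Lemma in_shape_shrink b : in_shape v b = (b == c) || in_shape v' b.
Proof.
rewrite /in_shape shrink_colE shrink_rowE.
have := perm_nat_eq v (col b) (col c); have := perm_nat_eq v (row b) (row c).
have := perm_nat_eq v (row b) (col c); have := perm_nat_eq v (col b) (row c).
have := row_neq_col b c; have := row_neq_col c b; rewrite box_eqE.
rewrite [col b == row c]eq_sym => /negbTE-> /negbTE->.
by case: (col b =P col c) => [->|_]; case: (row b =P row c) => [->|_] ; lia.
Qed.

Lemma in_shape_corner : in_shape v' c = false.
Proof. by rewrite /in_shape shrink_col shrink_row; lia. Qed.

Lemma count_below_shrink q : q != p.+1 -> count_below (v' \o W) q = count_below (v \o W) q.
Proof.
move=> qp; apply: eq_bigr => t _ /=; rewrite permM.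
case: tpermP => [->|e|//]; first lia.
move/perm_inj: e => e; have [_] := box_bounds c; have := ltn_ord t.
by rewrite -e /=; lia.
Qed.

Lemma count_below_corner : count_below (v \o W) p.+1 = (count_below (v \o W) p).+1.
Proof.
rewrite (count_belowS _ (@vW_inj _)) addnC; have [t et] := colW c.
have -> : [exists t, (v \o W) t == p :> nat] by apply/existsP; exists t; rewrite /= et.
by [].
Qed.

Lemma count_below_shrink_corner : count_below (v' \o W) p.+1 = count_below (v \o W) p.
Proof.
apply: eq_bigr => t _ /=; rewrite permM.
have h : v (W t) <> v (row c).
  by move/perm_inj => e; have [_] := box_bounds c; have := ltn_ord t; rewrite -e /=; lia.
case: tpermP => [->|//|ne _]; first lia.
have : v (W t) != p :> nat by apply/eqP => /val_inj.
lia.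
Qed.

Lemma count_below_swap (w : 'I_d -> 'I_n) : injective w ->
  [exists t, w t == p] -> ~~ [exists t, w t == v (row c)] ->
  forall q, count_below (s \o w) q = if q == p.+1 then count_below w p else count_below w q.
Proof.
move=> w_inj wp wp' q; have wp'' t : w t <> v (row c).
  by move=> e; case/existsP: wp'; exists t; apply/eqP.
case: (q =P p.+1 :> nat) => [->|ne].
  apply: eq_bigr => t _ /=.
  case: tpermP => [->|/wp'' //|h _]; first lia.
  have : w t != p :> nat by apply/eqP => /val_inj.
  lia.
apply: eq_bigr => t _ /=.
case: tpermP => [->|/wp'' //|//]; lia.
Qed.

(** When X(w) is stable under the simple reflection, the threshold p + 1
    carries no information of its own: the bound for the smaller rectangle
    follows from threshold p if p is not in w, and from p + 2 if p and p + 1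
    both are. *)
Lemma admissible_shrink_stable (w : 'I_d -> 'I_n) m : injective w ->
  ~~ ([exists t, w t == p] && ~~ [exists t, w t == v (row c)]) ->
  admissible v w m -> admissible v' w m.
Proof.
move=> w_inj hw gv q C sC aC.
case: (q =P p.+1 :> nat) => [eq|ne]; last first.
  rewrite count_below_shrink; last exact/eqP.
  apply: gv => //; apply: sub_all aC => b /andP[-> h] /=.
  by apply: in_rect_shrink h; apply/eqP.
move: aC; rewrite eq count_below_shrink_corner => aC.
have aC' : all (fun b => (0 < m b) && ((v (col b) < p) && (p.+1 < v (row b))))%N C.
  by apply: sub_all aC => b /andP[-> /in_rect_corner].
case: (boolP [exists t, w t == p]) hw => [wp|wp _].
  rewrite andTb negbK => wp'.
  have := gv p.+2 C sC; rewrite (count_belowS _ w_inj) (count_belowS _ (@vW_inj _)) count_below_corner.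
  have -> : [exists t, w t == p.+1 :> nat].
    by apply: etrans wp'; apply: eq_existsb => t; rewrite -corner.
  have -> : [exists t, (v \o W) t == p.+1 :> nat] = false.
    apply/existsP => -[t]; rewrite /= -corner perm_nat_eq => /eqP e.
    by have [_] := box_bounds c; have := ltn_ord t; rewrite -e /=; lia.
  suff h : all (fun b => (0 < m b)%N && in_rect v p.+2 b) C by move=> /(_ h); lia.
  by apply: sub_all aC' => b /=; rewrite /in_rect; lia.
rewrite (count_belowS _ w_inj).
have -> : [exists t, w t == p :> nat] = false by apply: etrans (negbTE wp).
have := gv p C sC.
suff h : all (fun b => (0 < m b)%N && in_rect v p b) C by move=> /(_ h); lia.
by apply: sub_all aC' => b /=; rewrite /in_rect; lia.
Qed.

(** A chain in the smaller rectangle is extended by the corner itself, which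
    comes after all of it; this is why the bound drops by one. *)
Lemma admissible_shrink_link (w : 'I_d -> 'I_n) m : (0 < m c)%N ->
  admissible v w m -> admissible v' w m.
Proof.
move=> mc gv q C sC aC.
case: (q =P p.+1 :> nat) => [eq|ne]; last first.
  rewrite count_below_shrink; last exact/eqP.
  apply: gv => //; apply: sub_all aC => b /andP[-> h] /=.
  by apply: in_rect_shrink h; apply/eqP.
move: aC; rewrite eq count_below_shrink_corner => aC.
have aC' : all (fun b => (0 < m b) && ((v (col b) < p) && (p.+1 < v (row b))))%N C.
  by apply: sub_all aC => b /andP[-> /in_rect_corner].
have := gv p.+1 (rcons C c); rewrite size_rcons count_below_corner.
have h1 : sorted (@box_lt n d) (rcons C c).
  rewrite (sorted_pairwise (@box_lt_trans n d)) pairwise_rcons -(sorted_pairwise (@box_lt_trans n d)) sC andbT.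
  apply: sub_all aC' => b /and3P[_ b1 b2]; rewrite /box_lt.
  have [cd dr] := box_bounds c; have [cd' dr'] := box_bounds b.
  have h1 := v_gr (i := col c) (j := col b); have h2 := v_gr (i := row b) (j := row c).
  have e1 := perm_nat_eq v (col b) (col c); have e2 := perm_nat_eq v (row b) (row c).
  rewrite -val_eqE /= in e1; rewrite -val_eqE /= in e2.
  by move: h1 h2 e1 e2; lia.
suff h : all (fun b => (0 < m b)%N && in_rect v p.+1 b) (rcons C c).
  by move=> /(_ h1 h); lia.
rewrite all_rcons mc /in_rect corner !leqnn /=.
by apply: sub_all aC' => b /=; lia.
Qed.

(** Both counts at threshold p + 1 drop to those at p, and the smaller rectangle
    lies in the one of threshold p. *)
Lemma admissible_shrink_swap (w : 'I_d -> 'I_n) m : injective w ->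
  [exists t, w t == p] -> ~~ [exists t, w t == v (row c)] ->
  admissible v w m -> admissible v' (s \o w) m.
Proof.
move=> w_inj wp wp' gv q C sC aC; rewrite count_below_swap //.
case: (q =P p.+1 :> nat) => [eq|ne]; last first.
  rewrite count_below_shrink; last exact/eqP.
  apply: gv => //; apply: sub_all aC => b /andP[-> h] /=.
  by apply: in_rect_shrink h; apply/eqP.
move: aC; rewrite eq count_below_shrink_corner => aC.
apply: gv => //; apply: sub_all aC => b /andP[-> /in_rect_corner].
by rewrite /in_rect; lia.
Qed.

Lemma grassmannian_shrink : grassmannian v'.
Proof.
have [cd dr] := box_bounds c.
move=> i j ij ijd; rewrite !permM.
have h := v_gr ij ijd.
case: tpermP => [/perm_inj e|/perm_inj e|ne1 ne2];
  case: tpermP => [/perm_inj e'|/perm_inj e'|ne1' ne2'] //.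
- by move: ij; rewrite e e' ltnn.
- by move: ij ijd; rewrite e e'; lia.
- by move: h; rewrite e; have : v j != v (row c) by [exact/eqP]; rewrite -val_eqE /=; lia.
- by move: ij ijd; rewrite e e'; lia.
- by move: ij; rewrite e e' ltnn.
- by move: h; rewrite e; lia.
- by move: h; rewrite e'; lia.
- by move: h; rewrite e'; have : v i != v (col c) by [exact/eqP]; rewrite -val_eqE /=; lia.
Qed.

End Corner.

(** A box with minimal difference of labels is a corner: a value strictly between
    the two labels is a pivot or not, and either way gives a smaller box. *)
Lemma exists_corner v : [exists b, in_shape v b] ->
  exists c, v (row c) = (v (col c)).+1 :> nat.
Proof.
case/existsP => b0 b0s.
case: (arg_minnP (fun b => v (row b) - v (col b))%N b0s) => c cs c_min.
exists c; have [cd dr] := box_bounds c.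
case: (ltnP (v (col c)).+1 (v (row c))) => [gap|]; last by move: cs; rewrite /in_shape; lia.
have lt_n : ((v (col c)).+1 < n)%N by apply: ltn_trans gap _.
pose y := (v^-1)%g (Ordinal lt_n); have vy : v y = (v (col c)).+1 :> nat by rewrite permKV.
case: (ltnP y d) => yd.
  have yP : ((y, row c).1 < d <= (y, row c).2)%N by rewrite /= yd.
  have := c_min (Sub (y, row c) yP).
  rewrite /in_shape /bcol /brow SubK /= -/(brow c) -/(bcol c) vy gap; lia.
have yP : ((col c, y).1 < d <= (col c, y).2)%N by rewrite /= cd.
have := c_min (Sub (col c, y) yP).
rewrite /in_shape /bcol /brow SubK /= -/(brow c) -/(bcol c) vy ltnSn; lia.
Qed.

(** The base of the induction.  In an empty diagram all pivots of v lie above all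
    other values, and the bounds for the empty chain force w to have the same
    values. *)
Lemma admissible_shape0 v w m : injective w -> ~~ [exists b, in_shape v b] ->
  admissible v w m -> exists s : 'S_d, forall t, w t = v (W (s t)).
Proof.
move=> w_inj noshape gv.
have ex t : exists u, w t == v (W u).
  pose y := (v^-1)%g (w t); have vy : v y = w t by rewrite permKV.
  case: (ltnP y d) => yd.
    by exists (Ordinal yd); rewrite -vy (inj_eq perm_inj); apply/eqP/val_inj.
  have := gv (w t).+1 [::] isT isT; rewrite add0n.
  have : (0 < count_below w (w t).+1)%N by rewrite /count_below (bigD1 t) //= ltnSn.
  move=> h1 h2; have : (0 < count_below (v \o W) (w t).+1)%N by apply: leq_trans h2.
  rewrite /count_below lt0n sum_nat_eq0 => /forallPn[u]; rewrite implyTb eqb0 negbK /= ltnS => hu.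
  have uP : ((W u, y).1 < d <= (W u, y).2)%N by rewrite /= ltn_ord.
  case/existsP: noshape; exists (Sub (W u, y) uP).
  rewrite /in_shape /bcol /brow SubK /= vy ltn_neqAle hu andbT.
  by apply/eqP => /val_inj; rewrite -vy => /perm_inj /(congr1 val) /=; have := ltn_ord u; lia.
have inj_f : injective (fun t => xchoose (ex t)).
  move=> t u e; apply: w_inj.
  by rewrite (eqP (xchooseP (ex t))) (eqP (xchooseP (ex u))) e.
by exists (perm inj_f) => t; rewrite permE; apply/eqP/(xchooseP (ex t)).
Qed.

(** * Charts of the Grassmannian and Bruhat cells *)

(** The rows of the matrix [1; X] permuted by v, with the entries outside the
    diagram of v put to 0: row v t is the unit vector e_t, and row v k carries
    the coordinates X _ k.  The entries of X that are not indexed by boxes of the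
    diagram are ignored.  The scalars form any ring, because the same matrix is
    used over K, over K[t] and over the local ring. *)
Definition chart (T : pzRingType) v (X : 'I_n -> 'I_n -> T) : 'M[T]_(n, d) := \matrix_(i, j)
  let k := (v^-1)%g i in
  if (k < d)%N then (k == W j)%:R else if (v (W j) < i)%N then X (W j) k else 0.

Lemma chartE (T : pzRingType) v (X : 'I_n -> 'I_n -> T) k j : chart v X (v k) j =
  if (k < d)%N then (k == W j)%:R else if (v (W j) < v k)%N then X (W j) k else 0.
Proof. by rewrite mxE permK. Qed.

Section Charts.
Variable K : fieldType.
Implicit Types (X Y : 'I_n -> 'I_n -> K) (M : 'M[K]_(n, d)).

Definition upper (b : 'M[K]_n) : Prop :=
  (forall i j : 'I_n, (j < i)%N -> b i j = 0) /\ forall i, b i i != 0.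

Definition coord_mx w : 'M[K]_(n, d) := \matrix_(i, t) (i == w t)%:R.

(** The column span of M lies in the B-orbit of the coordinate subspace of w. *)
Definition in_cell w M : Prop :=
  exists (b : 'M[K]_n) (g : 'M[K]_d), [/\ upper b, g \in unitmx & M = b *m coord_mx w *m g].

Lemma upper_mul (b b' : 'M[K]_n) : upper b -> upper b' -> upper (b *m b').
Proof.
move=> [b0 bd] [b'0 b'd]; split=> [i j ji|i].
  rewrite mxE big1 // => k _; case: (ltnP k i) => ki; first by rewrite b0 ?mul0r.
  by rewrite b'0 ?mulr0 //; apply: leq_trans ki.
rewrite mxE (bigD1 i) //= big1 ?addr0 ?mulf_neq0 // => k ne.
case: (ltnP k i) => ki; first by rewrite b0 ?mul0r.
by rewrite b'0 ?mulr0 // ltn_neqAle ki andbT; apply: contra ne => /eqP/val_inj->.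
Qed.

Lemma in_cell_mul w (b : 'M[K]_n) M (g : 'M[K]_d) : upper b -> g \in unitmx -> in_cell w M ->
  in_cell w (b *m M *m g).
Proof.
move=> ub ug [b' [g' [ub' ug' ->]]]; exists (b *m b'), (g' *m g); split.
- exact: upper_mul.
- by rewrite unitmx_mul ug' ug.
- by rewrite !mulmxA.
Qed.

Lemma upper1 : upper 1%:M.
Proof.
split=> [i j ji|i]; rewrite mxE ?eqxx ?oner_neq0 //.
by case: eqP => // e; rewrite e ltnn in ji.
Qed.

Lemma coord_mx_in_cell v w X (s : 'S_d) : ~~ [exists b, in_shape v b] ->
  (forall t, w t = v (W (s t))) -> in_cell w (chart v X).
Proof.
move=> noshape ws; exists 1%:M, (perm_mx s); split.
- exact: upper1.
- exact: unitmx_perm.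
rewrite mul1mx -[s]invgK -col_permE; apply/matrixP => i j; rewrite !mxE ws permKV.
have := permKV v i; set k := (v^-1)%g i => <-; rewrite (inj_eq perm_inj).
cbv zeta; case: (ltnP k d) => // dk; case: ifP => [lt|_].
  have kP : ((W j, k).1 < d <= (W j, k).2)%N by rewrite /= ltn_ord.
  by case/existsP: noshape; exists (Sub (W j, k) kP); rewrite /in_shape /bcol /brow SubK.
case: eqP => // e; move: dk; rewrite e /=; have := ltn_ord j; lia.
Qed.

Section CornerMoves.
Variables (v : 'S_n) (c : proot n d).
Hypothesis corner : v (row c) = (v (col c)).+1 :> nat.
Local Notation p := (v (col c)).
Local Notation p' := (v (row c)).
Local Notation s := (tperm p p').
Local Notation v' := (v * s)%g.

(** The point with coordinate x at the corner whose Schur complement with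
    respect to x is Y. *)
Definition schur_point (x : K) Y (j k : 'I_n) : K :=
  if (j == col c) && (k == row c) then x else
  Y j k + (if (v j < p)%N && (p' < v k)%N then Y (col c) k * Y j (row c) / x else 0).

Definition fill_point (x : K) Y (j k : 'I_n) : K :=
  if (j == col c) && (k == row c) then x else Y j k.

Lemma corner_neq : p != p'.
Proof. by rewrite -val_eqE /=; lia. Qed.

(** The Schur complement is one step of Gaussian elimination.  Clearing row p + 1
    against the entry x by column operations subtracts the Schur correction from
    the rows below; what remains in rows p and p + 1 is brought to the form of
    the smaller chart by an upper triangular 2 x 2 matrix. *)
Lemma schur_point_in_cell w x Y : x != 0 ->
  in_cell w (chart v' Y) -> in_cell w (chart v (schur_point x Y)).
Proof.
move=> x0 hY; have [cd dr] := box_bounds c.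
have [tc tcE] := colW c.
(* b acts on rows p and p + 1 only, g adds multiples of column tc to the columns
   of the pivots smaller than p. *)
pose b : 'M[K]_n := \matrix_(i, j) if i == p then (if j == p then - x^-1 else (j == p')%:R)
  else if i == p' then (j == p')%:R * x else (i == j)%:R.
pose r l := if (v (W l) < p)%N then Y (W l) (row c) / x else 0.
pose g : 'M[K]_d := 1%:M + \matrix_(j, l) ((j == tc)%:R * r l).
have rtc : r tc = 0 by rewrite /r tcE ltnn.
have ub : upper b.
  split=> [i j ji|i]; rewrite mxE.
    case: (i =P p) => [e|_]; first by move: ji; rewrite e -!val_eqE /= => ji; rewrite !ltn_eqF //; lia.
    case: (i =P p') => [e|_]; last by case: eqP => // e; rewrite e ltnn in ji.
    by case: (j =P p') => [e'|_]; rewrite ?mul0r //; move: ji; rewrite e e' ltnn.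
  case: (i =P p) => [_|_]; first by rewrite oppr_eq0 invr_eq0.
  by case: (i =P p') => [_|_]; rewrite ?mul1r ?eqxx ?oner_eq0.
have ug : g \in unitmx.
  have gE : (1%:M - \matrix_(j, l) ((j == tc)%:R * r l)) *m g = 1%:M.
    apply/matrixP => i l; rewrite mulmxBl mul1mx mulmxDr mulmx1 !mxE.
    rewrite [X in _ - (_ + X)]big1; last first.
      move=> k _; rewrite !mxE; case: (k =P tc) => [->|_]; last by rewrite mul0r mulr0.
      by rewrite rtc mulr0 mul0r.
    by rewrite addr0 addrK.
  by have [] := mulmx1_unit gE.
have bE (C : 'M[K]_(n, d)) i l : (b *m C) i l =
    if i == p then - x^-1 * C p l + C p' l else if i == p' then x * C p' l else C i l.
  rewrite mxE; case: (i =P p) => [->|ne].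
    rewrite (bigD1 p) //= (bigD1 p') /=; last by rewrite eq_sym corner_neq.
    rewrite !mxE !eqxx [p' == p]eq_sym (negbTE corner_neq) mul1r big1 ?addr0 // => k /andP[k1 k2].
    by rewrite mxE eqxx (negbTE k1) (negbTE k2) mul0r.
  case: (i =P p') => [->|ne'].
    rewrite (bigD1 p') //= big1 ?addr0; last first.
      by move=> k k1; rewrite mxE eqxx [p' == p]eq_sym (negbTE corner_neq) (negbTE k1) !mul0r.
    by rewrite mxE eqxx [p' == p]eq_sym (negbTE corner_neq) mul1r.
  rewrite (bigD1 i) //= big1 ?addr0; last first.
    by move=> k k1; rewrite mxE; do 2 case: eqP => // _; rewrite eq_sym (negbTE k1) mul0r.
  by rewrite mxE; do 2 case: eqP => // _; rewrite eqxx mul1r.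
suff -> : chart v (schur_point x Y) = b *m chart v' Y *m g by apply: in_cell_mul.
have Cp l : chart v' Y p l = if (v (W l) < p)%N then Y (W l) (row c) else 0.
  have := chartE v' Y (row c) l; rewrite shrink_row => ->; rewrite ifN -?leqNgt //.
  rewrite permM; case: tpermP => [->|/perm_inj e|//]; last first.
    by move: dr; rewrite -e /=; have := ltn_ord l; lia.
  by rewrite ltnn ifN //; lia.
have Cp' l : chart v' Y p' l = (l == tc)%:R.
  have := chartE v' Y (col c) l; rewrite shrink_col => ->; rewrite cd -tcE; congr (nat_of_bool _)%:R.
  by apply/eqP/eqP => [/(congr1 val) /= /val_inj|->].
have Ck k l : k != col c -> k != row c -> chart v' Y (v k) l =
   if (k < d)%N then (k == W l)%:R else if (v' (W l) < v k)%N then Y (W l) k else 0.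
  by move=> k1 k2; have := chartE v' Y k l; rewrite shrink_other.
apply/matrixP => i l; rewrite mulmxDr mulmx1 [RHS]mxE [X in _ + X]mxE.
rewrite (bigD1 tc) //= big1 ?addr0; last first.
  by move=> j jt; rewrite [X in _ * X]mxE (negbTE jt) mul0r mulr0.
rewrite [X in _ * X]mxE eqxx mul1r !bE.
have := permKV v i; set k := (v^-1)%g i => <-; rewrite chartE.
rewrite !(inj_eq perm_inj) !Cp !Cp' eqxx !tcE ltnn.
case: (k =P col c) => [->|/eqP kc].
  rewrite cd mulr0 add0r mul1r /r.
  have -> : (col c == W l) = (l == tc).
    by rewrite -tcE; apply/eqP/eqP => [/(congr1 val)/= /val_inj|->].
  by case: ifP => _; rewrite ?mulr0 ?add0r ?addr0 // mulNr [_ / x]mulrC addrAC addNr add0r.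
case: (k =P row c) => [->|/eqP kr].
  rewrite ltnNge dr /= /schur_point eqxx andbT corner ltnS ltnn andbF addr0 mulr1.
  have -> : (W l == col c) = (l == tc).
    by rewrite -tcE; apply/eqP/eqP => [/(congr1 val)/= /val_inj|->].
  rewrite /r; case: (l =P tc) => [->|/eqP lt].
    by rewrite tcE leqnn ltnn !mulr1 mulr0 addr0.
  have ne : v (W l) != p :> nat.
    rewrite perm_nat_eq -tcE; apply: contra lt => /eqP/(congr1 val) /= /val_inj ->; exact: eqxx.
  rewrite mulr0 add0r leq_eqVlt (negbTE ne) /=; case: ifP => _; last by rewrite mulr0.
  by rewrite mulrC divfK.
rewrite !Ck //; case: (ltnP k d) => kd.
  by rewrite tcE (negbTE kc) mul0r addr0.
have v'tc : v' (col c) = p' by rewrite shrink_col.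
rewrite tcE v'tc /schur_point (negbTE kr) andbF /r.
have v'l : v' (W l) = (if l == tc then p' else v (W l)).
  case: eqP => [->|lt]; first by rewrite tcE.
  apply: shrink_other; last by apply/eqP => e; move: dr; rewrite -e /=; have := ltn_ord l; lia.
  by rewrite -tcE; apply/eqP => /(congr1 val) /= /val_inj.
rewrite v'l; have nek := perm_nat_eq v k (row c); have nek' := perm_nat_eq v k (col c).
rewrite (negbTE kr) in nek; rewrite (negbTE kc) in nek'.
case: (l =P tc) => [->|/eqP lt].
  rewrite tcE ltnn mulr0 !addr0 (_ : (p < v k)%N = (p' < v k)%N) //; lia.
case: (ltnP (v (W l)) p) => lp; last by rewrite mulr0 !addr0.
case: (ltnP p' (v k)) => pk; rewrite ?andbF ?mul0r ?addr0 //.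
have -> : (v (W l) < v k)%N by lia.
by rewrite mulrA.
Qed.

(** The chart of v at [fill_point x Y] is u(x) s applied to the smaller chart, u(x)
    being a lower unipotent of the minimal parabolic of s.  Moving s through the
    upper triangular matrix b leaves a single entry below the diagonal, and x is
    chosen to cancel it. *)
Lemma fill_point_in_cell w Y :
  in_cell (s \o w) (chart v' Y) -> exists x, in_cell w (chart v (fill_point x Y)).
Proof.
move=> [b [g [[ub db] ug e]]]; have [cd dr] := box_bounds c.
have [tc tcE] := colW c.
pose x := - b p p' / b p' p'; exists x.
pose E : 'M[K]_n := 1%:M + x *: delta_mx p' p.
pose b' := E *m (perm_mx s *m b *m perm_mx s).
have bsE i j : (perm_mx s *m b *m perm_mx s) i j = b (s i) (s j).
  by rewrite -row_permE -{2}(tpermV p p') -col_permE !mxE.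
exists b', g; split=> //.
- have b'E i j : b' i j = b (s i) (s j) + (i == p')%:R * x * b p' (s j).
    rewrite /b' mulmxDl mul1mx [LHS]mxE bsE; congr (_ + _).
    rewrite -scalemxAl [LHS]mxE [X in _ * X]mxE (bigD1 p) //= big1 ?addr0.
      by rewrite bsE mxE eqxx andbT tpermL mulrCA mulrA.
    by move=> k kp; rewrite [X in X * _]mxE (negbTE kp) andbF mul0r.
  have ne := corner_neq.
  split=> [i j ji|i]; rewrite b'E.
    case: (i =P p') => [ip'|/eqP ip']; last first.
      rewrite !mul0r addr0; have ip'n : i != p' :> nat by rewrite val_eqE.
      case: (tpermP p p' i) => [ei|ei|_ _]; last 1 first.
      + by case: tpermP => [ej|ej|_ _]; rewrite ub //; move: ji; rewrite ej; lia.
      + rewrite tpermD ?ub //; first by move: ji; rewrite ei; lia.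
          by apply: contraTneq ji => <-; rewrite ei ltnn.
        by apply: contraTneq ji => <-; rewrite ei; lia.
      + by rewrite ei eqxx in ip'n.
    rewrite ip' in ji *; rewrite tpermR mul1r; case: (j =P p) => [->|/eqP jp].
      by rewrite tpermL /x divfK ?addrN.
    have jp' : j != p' by apply: contraTneq ji => ->; rewrite ltnn.
    have jlt : (j < p)%N.
      have : j != p :> nat by rewrite val_eqE.
      by move: ji; lia.
    rewrite tpermD 1?eq_sym // !ub ?mulr0 ?addr0 //; lia.
  case: (i =P p') => [->|/eqP ip']; last by rewrite !mul0r addr0.
  by rewrite tpermR [b p' p]ub ?mulr0 ?addr0 ?db // corner.
- suff -> : chart v (fill_point x Y) = E *m perm_mx s *m chart v' Y.
    rewrite e !mulmxA; congr (_ *m _).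
    have -> : coord_mx (s \o w) = perm_mx s *m coord_mx w.
      rewrite -row_permE; apply/matrixP => i t; rewrite !mxE /=.
      by rewrite (canF_eq (tpermK _ _)).
    by rewrite /b' !mulmxA.
  have EsE (C : 'M[K]_(n, d)) i l :
      (E *m perm_mx s *m C) i l = C (s i) l + (i == p')%:R * (x * C p' l).
    rewrite -mulmxA -row_permE mulmxDl mul1mx [LHS]mxE [X in X + _]mxE; congr (_ + _).
    rewrite -scalemxAl [LHS]mxE [X in _ * X]mxE (bigD1 p) //= big1 ?addr0.
      by rewrite !mxE eqxx andbT tpermL mulrCA.
    by move=> k kp; rewrite [X in X * _]mxE (negbTE kp) andbF mul0r.
  apply/matrixP => i l; rewrite EsE.
  have := permKV v i; set k := (v^-1)%g i => <-; rewrite chartE.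
  rewrite (inj_eq perm_inj) (_ : s (v k) = v' k); last by rewrite permM.
  rewrite chartE.
  have Cp' : chart v' Y p' l = (l == tc)%:R.
    have := chartE v' Y (col c) l; rewrite shrink_col => ->; rewrite cd -tcE; congr (nat_of_bool _)%:R.
    by apply/eqP/eqP => [/(congr1 val) /= /val_inj|->].
  have ltc : (W l == col c) = (l == tc).
    by rewrite -tcE; apply/eqP/eqP => [/(congr1 val)/= /val_inj|->].
  have Wl : W l != row c by apply/eqP => e'; move: dr; rewrite -e' /=; have := ltn_ord l; lia.
  have v'l : v' (W l) = (if l == tc then p' else v (W l)).
    by rewrite -ltc; case: eqP => [->|/eqP lt]; [rewrite shrink_col | rewrite shrink_other].
  rewrite Cp' v'l /fill_point ltc.
  case: (k =P row c) => [->|/eqP kr].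
    rewrite shrink_row ltnNge dr /= corner !andbT mul1r.
    case: eqP => [lt|/eqP lt].
      move/eqP: ltc; rewrite lt eqxx => /eqP/eqP->; rewrite leqnn.
      by rewrite (_ : (p' < p)%N = false) ?add0r ?mulr1 //; lia.
    have ne : v (W l) != p :> nat by rewrite perm_nat_eq ltc.
    by rewrite mulr0 addr0 ltnS leq_eqVlt (negbTE ne).
  rewrite mul0r addr0 andbF; case: ifP => // kd.
  have kc : k != col c by apply: contraFneq kd => ->.
  rewrite (shrink_other v kc kr); case: eqP => [lt|//].
  move/eqP: ltc; rewrite lt eqxx => /eqP/eqP->.
  have := perm_nat_eq v k (row c); have := perm_nat_eq v k (col c).
  rewrite (negbTE kr) (negbTE kc) => n1 n2; rewrite (_ : (p < v k)%N = (p' < v k)%N) //; lia.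
Qed.
End CornerMoves.

End Charts.

(** * Independence of the admissible monomials on a cell *)

Lemma poly_closed_eq0 (K : closedFieldType) (q : {poly K}) :
  (forall t, t != 0 -> q.[t] = 0) -> q = 0.
Proof.
move=> q0; have : q * 'X == 0.
  apply: contraT => /closed_nonrootP[t]; rewrite rootE hornerM hornerX mulf_eq0 negb_or.
  by case/andP => qt /q0 e; rewrite e eqxx in qt.
by rewrite mulf_eq0 polyX_eq0 orbF => /eqP.
Qed.

(** The family is indexed by a predicate on a finite type, so that the induction
    can pass to the terms of top degree in the corner variable without
    reindexing; exponents only need to be distinct on the diagram. *)
Lemma monomials_independent (K : closedFieldType) v w (I : finType) (P : pred I)
    (m : I -> proot n d -> nat) (a : I -> K) :
  grassmannian v -> injective w -> (forall i, P i -> admissible v w (m i)) ->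
  (forall i j, P i -> P j -> (forall b, in_shape v b -> m i b = m j b) -> i = j) ->
  (forall X, in_cell w (chart v X) ->
     \sum_(i | P i) a i * \prod_(b | in_shape v b) X (col b) (row b) ^+ m i b = 0) ->
  forall i, P i -> a i = 0.
Proof.
have [N leN] := ubnP #|[set b | in_shape v b]|.
elim: N => // N IH in v w P leN *; move=> v_gr w_inj gm inj_m vanish i0 Pi0.
case: (boolP [exists b, in_shape v b]) => [/exists_corner[c corner]|noshape]; last first.
  have [s ws] := admissible_shape0 w_inj noshape (gm _ Pi0).
  have := vanish (fun _ _ => 0) (coord_mx_in_cell _ noshape ws).
  have noshape' b : in_shape v b = false.
    by apply: contraNF noshape => bs; apply/existsP; exists b.
  rewrite (big_pred1 i0) => [|i]; last first.
    apply/idP/eqP => [Pi|->//]; apply: inj_m => // b; by rewrite noshape'.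
  by rewrite big_pred0 ?mulr1.
apply/eqP/negPn/negP => ai0.
pose v' := (v * tperm (v (col c)) (v (row c)))%g.
pose P1 i := P i && (a i != 0).
have P1i0 : P1 i0 by rewrite /P1 Pi0.
have shrinkF b : in_shape v' b -> (b == c) = false.
  by move=> bs; apply: contraTF bs => /eqP->; rewrite (in_shape_corner corner).
have ltN : (#|[set b | in_shape v' b]| < N)%N.
  rewrite -ltnS; apply: leq_trans leN; rewrite ltnS.
  apply/proper_card/properP; split.
    by apply/subsetP => b; rewrite !inE (in_shape_shrink corner) => ->; rewrite orbT.
  exists c; rewrite inE; first by rewrite (in_shape_shrink corner) eqxx.
  by rewrite (in_shape_corner corner).
have v'_gr : grassmannian v' by apply: grassmannian_shrink.
have vanish1 X : in_cell w (chart v X) ->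
    \sum_(i | P1 i) a i * (X (col c) (row c) ^+ m i c *
       \prod_(b | in_shape v' b) X (col b) (row b) ^+ m i b) = 0.
  move=> cX; rewrite -[RHS](vanish X cX) [RHS]big_mkcond [LHS]big_mkcond /=.
  apply: eq_bigr => i _; rewrite /P1; case: (P i) => //=; case: (a i =P 0) => [->|_] /=; first by rewrite mul0r.
  rewrite [in RHS](bigD1 c) /=; last by rewrite (in_shape_shrink corner) eqxx.
  congr (_ * (_ * _)); apply: eq_bigl => b; rewrite (in_shape_shrink corner).
  case: (b =P c) => [->|_]; last by rewrite orFb andbT.
  by rewrite andbF (in_shape_corner corner).
(* k is the degree of the combination in the corner variable. *)
case: (arg_maxnP (fun i => m i c) P1i0) => i1 /andP[Pi1 ai1] maxi1.
set k := m i1 c in maxi1.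
case: (boolP ((0 < k)%N || ~~ ([exists t, w t == v (col c)] && ~~ [exists t, w t == v (row c)]))) => [hk|].
  pose P2 i := P1 i && (m i c == k).
  have P2i1 : P2 i1 by rewrite /P2 /P1 Pi1 ai1 eqxx.
  suff : a i1 = 0 by move/eqP; rewrite (negbTE ai1).
  apply: (IH v' w P2) P2i1 => //.
  - move=> i /andP[/andP[Pi _] /eqP mik]; have gi := gm i Pi.
    case/orP: hk => hk; first by apply: admissible_shrink_link => //; rewrite mik.
    exact: admissible_shrink_stable.
  - move=> i j /andP[/andP[Pi _] /eqP mik] /andP[/andP[Pj _] /eqP mjk] e.
    apply: inj_m => // b; rewrite (in_shape_shrink corner) => /orP[/eqP->|/e//].
    by rewrite mik mjk.
  move=> Y cY.
  (* t ^ k times the value at schur_point t^-1 Y is polynomial in t and vanishes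
     for t <> 0; its value at t = 0 is the leading coefficient at Y. *)
  pose q : {poly K} := \sum_(i | P1 i) (a i)%:P * ('X ^+ (k - m i c) *
    \prod_(b | in_shape v' b) ((Y (col b) (row b))%:P +
      (if (v (col b) < v (col c))%N && (v (row c) < v (row b))%N
       then (Y (col c) (row b) * Y (col b) (row c))%:P * 'X else 0)) ^+ m i b).
  have q0 : q.[0] = 0.
    rewrite (poly_closed_eq0 (q := q)) ?horner0 // => t t0; have tV0 : t^-1 != 0 by rewrite invr_eq0.
    have := vanish1 _ (schur_point_in_cell (c := c) corner tV0 cY).
    move/(congr1 (fun z => t ^+ k * z)); rewrite mulr0 => <-.
    rewrite /q horner_sum mulr_sumr; apply: eq_bigr => i P1i.
    rewrite !hornerM hornerC hornerXn horner_prod [RHS]mulrCA; congr (_ * _).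
    rewrite {1}/schur_point !eqxx /= mulrA; congr (_ * _).
      by rewrite -(subnK (maxi1 _ P1i)) exprD -mulrA -exprMn divff ?expr1n ?mulr1 ?addnK.
    apply: eq_bigr => b bs; rewrite horner_exp hornerD hornerC; congr (_ ^+ _).
    rewrite /schur_point -box_eqE shrinkF //.
    congr (_ + _); case: ifP => _; rewrite ?hornerC // hornerM hornerC hornerX.
    by rewrite invrK.
  rewrite -[RHS]q0 /q horner_sum /P2 [LHS]big_mkcondr /=.
  apply: eq_bigr => i P1i; rewrite !hornerM hornerC hornerXn horner_prod.
  case: eqP => [->|ne]; last first.
    have lt : (m i c < k)%N by rewrite ltn_neqAle [(_ <= _)%N]maxi1 // andbT; apply/eqP.
    by rewrite expr0n subn_eq0 leqNgt lt mul0r mulr0.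
  rewrite subnn expr0 mul1r; congr (_ * _); apply: eq_bigr => b bs.
  rewrite horner_exp hornerD hornerC; congr (_ ^+ _).
  by case: ifP => _; rewrite ?hornerM ?hornerX ?mulr0 ?hornerC addr0.
(* The corner variable does not occur and X(w) is not stable under s. *)
rewrite negb_or -leqNgt leqn0 negbK => /andP[/eqP k0 /andP[wp wp']].
have mc0 i : P1 i -> m i c = 0%N by move/maxi1 => h; apply/eqP; rewrite -leqn0 -k0.
have P1i1 : P1 i1 by rewrite /P1 Pi1.
case/negP: ai1; apply/eqP.
apply: (IH v' (tperm (v (col c)) (v (row c)) \o w) P1) => //.
- by move=> x y /= /perm_inj /w_inj.
- move=> i /andP[Pi _]; apply: admissible_shrink_swap => //; exact: gm.
- move=> i j P1i P1j e; have [/andP[Pi _] /andP[Pj _]] := (P1i, P1j).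
  apply: inj_m => // b; rewrite (in_shape_shrink corner) => /orP[/eqP->|/e//].
  by rewrite !mc0.
- move=> Y /(fill_point_in_cell corner)[x cX].
  rewrite -[RHS](vanish1 _ cX); apply: eq_bigr => i P1i.
  rewrite mc0 // expr0 mul1r; congr (_ * _); apply: eq_bigr => b bs; congr (_ ^+ _).
  by rewrite /fill_point -box_eqE shrinkF.
Qed.

End Shapes.

(** * Chains of commuting reflections *)

Section SortedTuples.
Variables (n d : nat).
Implicit Types (w u : Idn n d).

Lemma sum_ltn_ord k : (\sum_(t < d) (t < k) = minn k d)%N.
Proof.
elim: d => [|e IHe]; first by rewrite big_ord0 minn0.
by rewrite big_ord_recr /= IHe; lia.
Qed.

Lemma Idn_lt u (s t : 'I_d) : (s < t)%N -> (tnth (val u) s < tnth (val u) t)%N.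
Proof.
move=> st; have := valP u; rewrite /= => us.
have tr : transitive (fun i j : 'I_n => (i < j)%N) by move=> ? ? ?; apply: ltn_trans.
have x0 := tnth (val u) s; rewrite !(tnth_nth x0).
by apply: (sorted_ltn_nth tr) => //; rewrite inE size_tuple.
Qed.

Lemma Idn_le u (s t : 'I_d) : (s <= t)%N -> (tnth (val u) s <= tnth (val u) t)%N.
Proof. by rewrite leq_eqVlt => /orP[/eqP/val_inj->//|/(Idn_lt u)/ltnW]. Qed.

Lemma tnth_Idn_inj u : injective (tnth (val u)).
Proof.
move=> s t e; apply: val_inj => /=; have := @Idn_lt u s t; have := @Idn_lt u t s.
by rewrite e ltnn; lia.
Qed.

Lemma leq_Idn u (t : 'I_d) : (t <= tnth (val u) t)%N.
Proof.
case: t => t; elim: t => // t IHt lt_d; apply: leq_ltn_trans (IHt (ltnW lt_d)) _.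
exact: Idn_lt.
Qed.

(** A sorted tuple and its counting function determine each other; this converts
    the entrywise Bruhat order into inequalities between counts. *)
Lemma ltn_count_below u (t : 'I_d) q : (tnth (val u) t < q)%N = (t < count_below (tnth (val u)) q)%N.
Proof.
apply/idP/idP => h.
  have : (minn t.+1 d <= count_below (tnth (val u)) q)%N.
    rewrite -sum_ltn_ord; apply: leq_sum => s _; case: (ltnP s t.+1) => // st.
    by rewrite (leq_ltn_trans (Idn_le u st) h).
  by have := ltn_ord t; lia.
rewrite ltnNge; apply: contraL h => qt; rewrite -leqNgt.
have : (count_below (tnth (val u)) q <= minn t d)%N.
  rewrite -sum_ltn_ord; apply: leq_sum => s _; case: (ltnP _ q) => // uq.
  by case: (ltnP s t) => // /(Idn_le u); lia.
by lia.
Qed.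

Lemma bruhat_leP u w :
  reflect (forall q, (count_below (tnth (val w)) q <= count_below (tnth (val u)) q)%N) (bruhat_le u w).
Proof.
apply: (iffP forallP) => h.
  by move=> q; apply: leq_sum => t _; have := h t; case: ltnP => //; case: ltnP => //; lia.
move=> t; rewrite -ltnS ltn_count_below; apply: leq_trans (h _).
by rewrite -ltn_count_below.
Qed.

End SortedTuples.

Section Chains.
Variables (n d : nat) (le_dn : (d <= n)%N).
Implicit Types (w u : Idn n d) (a b : proot n d) (c : seq (proot n d)).
Local Notation W := (widen_ord le_dn).
Local Notation row b := (brow b).
Local Notation col b := (bcol b).

Lemma count_below_coset (s : 'S_n) q : count_below (tnth (val (coset_Idn le_dn s))) q = count_below (s \o W) q.
Proof.
rewrite /count_below.
rewrite -(big_tuple _ _ (coset_tuple le_dn s) xpredT (fun i : 'I_n => (i < q : nat)%N)).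
rewrite (perm_big [tuple s (W t) | t < d]) /=; last exact/permEl/perm_sort.
by rewrite big_image.
Qed.

Definition disjoint_boxes a b := (col a != col b) && (row a != row b).

Lemma box_lt_disjoint a b : box_lt a b -> disjoint_boxes a b.
Proof. by rewrite /box_lt /disjoint_boxes -!val_eqE /=; lia. Qed.

Lemma prod_refl_fix c x : all (fun b => (x != col b) && (x != row b)) c ->
  (\prod_(a <- c) refl_of a)%g x = x.
Proof.
elim: c => [|a c IHc] /=; first by rewrite big_nil perm1.
case/andP=> /andP[xa xa'] /IHc e; rewrite big_cons permM tpermD // eq_sym //.
Qed.

(** Each transposition of the product removes the column label of its box from the
    first d values and inserts the row label instead, which changes the count
    below q exactly when q separates the two labels. *)
Lemma count_below_prod_refl c q : pairwise disjoint_boxes c ->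
  (count_below ((\prod_(a <- c) refl_of a)%g \o W) q + count (in_rect 1 q) c = count_below W q)%N.
Proof.
elim: c => [|a c IHc] /=; first by rewrite big_nil addn0 => _; apply: eq_bigr => t _; rewrite /= perm1.
case/andP => /allP ac /IHc <-; rewrite big_cons addnA; congr (_ + _)%N.
set s := (\prod_(_ <- c) _)%g.
have [tc tcE] := colW le_dn a; have [ad da] := box_bounds a.
rewrite /count_below (bigD1 tc) //= [in RHS](bigD1 tc) //= tcE permM tpermL.
have sr : s (row a) = row a.
  apply: prod_refl_fix; apply/allP => b /ac /andP[_ ->]; rewrite andbT; exact: row_neq_col.
have sc : s (col a) = col a.
  apply: prod_refl_fix; apply/allP => b /ac /andP[-> _]; rewrite eq_sym; exact: row_neq_col.
have -> : (\sum_(i < d | i != tc) ((refl_of a * s)%g (W i) < q) =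
           \sum_(i < d | i != tc) (s (W i) < q))%N.
  apply: eq_bigr => t ne; rewrite permM tpermD //.
    by rewrite -/(bcol a) -tcE; apply: contra ne => /eqP/(congr1 val) /= /val_inj->.
  by rewrite -/(brow a); apply/eqP => e; have := ltn_ord t; move: da; rewrite e /=; lia.
by rewrite -/(brow a) sr sc /in_rect !perm1; move: (\sum_(i < d | i != tc) (s (W i) < q))%N => z; lia.
Qed.

Lemma count_below_refl a q : (count_below (refl_of a \o W) q + in_rect 1 q a = count_below W q)%N.
Proof. by have := @count_below_prod_refl [:: a] q isT; rewrite /= big_seq1 addn0. Qed.

Lemma bruhat_le_refl a b :
  bruhat_le (coset_Idn le_dn (refl_of b)) (coset_Idn le_dn (refl_of a))
  = (col a <= col b)%N && (row b <= row a)%N.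
Proof.
have [bd db] := box_bounds b.
apply/bruhat_leP/andP => [h|[h1 h2] q].
  have := h (col b).+1; have := h (row b); rewrite !count_below_coset.
  have := count_below_refl a (col b).+1; have := count_below_refl a (row b).
  have := count_below_refl b (col b).+1; have := count_below_refl b (row b).
  rewrite /in_rect !perm1; split; lia.
rewrite !count_below_coset; have := count_below_refl a q; have := count_below_refl b q.
rewrite /in_rect !perm1; lia.
Qed.

Lemma refl_commute_disjoint a b : a != b -> commute (refl_of a) (refl_of b) ->
  disjoint_boxes a b.
Proof.
have [ad da] := box_bounds a; have [bd db] := box_bounds b.
rewrite box_eqE /disjoint_boxes => ne cab.
have ab := row_neq_col a b; have ba := row_neq_col b a.
rewrite -negb_or; apply: contra ne => /orP[/eqP e|/eqP e].
  apply: contraT; rewrite e eqxx /= => ne.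
  move/permP/(_ (col a)): cab; rewrite !permM /refl_of -/(bcol a) -/(brow a) -/(bcol b) -/(brow b).
  rewrite e !tpermL tpermD // 1?eq_sym // tpermD // -?e 1?eq_sym // => /eqP.
  by rewrite (negbTE ne).
apply: contraT; rewrite e eqxx andbT => ne.
move/permP/(_ (row a)): cab; rewrite !permM /refl_of -/(bcol a) -/(brow a) -/(bcol b) -/(brow b).
rewrite e !tpermR tpermD // 1?eq_sym // -?e // tpermD // 1?eq_sym // => /eqP.
by rewrite (negbTE ne).
Qed.

Lemma disjoint_refl_commute a b : disjoint_boxes a b -> commute (refl_of a) (refl_of b).
Proof.
case/andP => cc rr; have ab := row_neq_col a b; have ba := row_neq_col b a.
rewrite /commute conjgC tpermJ /refl_of !tpermD // eq_sym //.
Qed.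

Lemma commuting_chainE c :
  commuting_chain le_dn c <-> c != [::] /\ sorted (@box_lt n d) c.
Proof.
split=> [[c0 cc sc]|[c0 sc]]; split=> //.
- apply: (sub_in_sorted (P := mem c)) sc; last exact/allP.
  move=> a b ac bc /andP[ne]; rewrite bruhat_le_refl => /andP[h1 h2].
  have /andP[] : disjoint_boxes a b.
    by apply: refl_commute_disjoint (cc _ _ ac bc); apply: contra ne => /eqP->.
  by rewrite -!val_eqE /box_lt /=; lia.
- move=> a b ac bc; case: (a =P b) => [->|/eqP ne]; first exact: commute_refl.
  have := sorted_ltn_index (@box_lt_trans n d) sc; rewrite /sorted => lt_index.
  have : index a c != index b c by apply: contra ne => /eqP/index_inj->.
  rewrite neq_ltn => /orP[/lt_index h|/lt_index h].
    exact/disjoint_refl_commute/box_lt_disjoint/h.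
  exact/commute_sym/disjoint_refl_commute/box_lt_disjoint/h.
- apply: sub_sorted sc => a b ab; rewrite /bruhat_lt bruhat_le_refl.
  apply/andP; split; last by move: ab; rewrite /box_lt; lia.
  apply/eqP => e; have : bruhat_le (coset_Idn le_dn (refl_of a)) (coset_Idn le_dn (refl_of b)).
    by rewrite e; apply/bruhat_leP.
  by rewrite bruhat_le_refl; move: ab; rewrite /box_lt; lia.
Qed.

(** The product of a chain c is at most w iff, for all q, the boxes of c in the
    rectangle of q, which form a chain again, obey the bound of q. *)
Lemma in_Sw_admissible w (S : multiset (proot n d)) :
  in_Sw le_dn w S <-> admissible le_dn 1 (tnth (val w)) S.
Proof.
have W1 q : count_below ((1 : 'S_n)%g \o W) q = count_below W q by apply: eq_bigr => t _; rewrite /= perm1.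
have pw c : sorted (@box_lt n d) c -> pairwise disjoint_boxes c.
  rewrite (sorted_pairwise (@box_lt_trans n d)).
  by apply: sub_pairwise => a b; apply: box_lt_disjoint.
split=> [Sw q C sC aC|gS c /commuting_chainE[c0 sc] cS].
  rewrite W1.
  have [->|C0] := eqVneq C [::].
    rewrite add0n; have -> : count_below W q = minn q d.
      by rewrite -sum_ltn_ord; apply: eq_bigr.
    rewrite leq_min; apply/andP; split; last first.
      by rewrite -[X in (_ <= X)%N](card_ord d) -sum1_card; apply: leq_sum => t _; exact: leq_b1.
    rewrite leqNgt; apply/negP => h.
    have h' : (count_below (tnth (val w)) q <= d)%N.
      by rewrite -[X in (_ <= X)%N](card_ord d) -sum1_card; apply: leq_sum => t _; exact: leq_b1.
    have qd : (q < d)%N by apply: leq_trans h h'.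
    by have := ltn_count_below w (Ordinal qd) q; rewrite /= h ltnNge (leq_Idn w (Ordinal qd)).
  have cC : commuting_chain le_dn C by apply/commuting_chainE.
  have CS : {subset C <= S}.
    by move=> b bC; have /andP[+ _] := allP aC _ bC; rewrite -in_mset.
  have /bruhat_leP/(_ q) := Sw C cC CS; rewrite count_below_coset.
  have := count_below_prod_refl q (pw _ sC).
  have -> : count (in_rect 1 q) C = size C.
    by apply/eqP; rewrite -all_count; apply: sub_all aC => b /andP[].
  by lia.
apply/bruhat_leP => q; rewrite count_below_coset.
have := count_below_prod_refl q (pw _ sc).
have := gS q (filter (in_rect 1 q) c); rewrite W1 size_filter.
have h1 : sorted (@box_lt n d) (filter (in_rect 1 q) c).
  by apply: sorted_filter sc; exact: box_lt_trans.
suff h2 : all (fun b => (0 < S b)%N && in_rect 1 q b) (filter (in_rect 1 q) c).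
  by move=> /(_ h1 h2); lia.
apply/allP => b; rewrite mem_filter => /andP[-> /cS]; by rewrite andbT -in_mset.
Qed.

End Chains.

(** * Powers of an ideal and leading forms *)

Section IdealPowers.
Variables (A : comPzRingType) (I : A -> Prop).
Implicit Types (x y : A).

Lemma ideal_pow0 k : ideal_pow I k 0.
Proof. by exists 0%N, (fun _ => 0), (fun _ _ => 0); split=> [[]//|]; rewrite big_ord0. Qed.

Lemma ideal_powD k x y : ideal_pow I k x -> ideal_pow I k y -> ideal_pow I k (x + y).
Proof.
move=> [r [c [f [If ->]]]] [r' [c' [f' [If' ->]]]].
exists (r + r')%N, (fun i => match split i with inl i => c i | inr i => c' i end),
  (fun i => match split i with inl i => f i | inr i => f' i end); split.
  by move=> i j; case: (split i).
rewrite big_split_ord /=; congr (_ + _); apply: eq_bigr => i _.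
  by rewrite (unsplitK (inl i : 'I_r + 'I_r')).
by rewrite (unsplitK (inr i : 'I_r + 'I_r')).
Qed.

Lemma ideal_powMl k a x : ideal_pow I k x -> ideal_pow I k (a * x).
Proof.
move=> [r [c [f [If ->]]]]; exists r, (fun i => a * c i), f; split=> //.
by rewrite mulr_sumr; apply: eq_bigr => i _; rewrite mulrA.
Qed.

Lemma ideal_powN k x : ideal_pow I k x -> ideal_pow I k (- x).
Proof. by move=> /(ideal_powMl (-1)); rewrite mulN1r. Qed.

Lemma ideal_pow_prod k (f : 'I_k -> A) : (forall j, I (f j)) -> ideal_pow I k (\prod_j f j).
Proof.
by move=> If; exists 1%N, (fun _ => 1), (fun _ => f); split=> //; rewrite big_ord1 mul1r.
Qed.

(** Elements of a power of an ideal are reached additively from multiples of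
    products of generators. *)
Lemma ideal_pow_ind k (Q : A -> Prop) : Q 0 -> (forall x y, Q x -> Q y -> Q (x + y)) ->
  (forall a (f : 'I_k -> A), (forall j, I (f j)) -> Q (a * \prod_j f j)) ->
  forall x, ideal_pow I k x -> Q x.
Proof. by move=> Q0 QD QM x [r [c [f [If ->]]]]; elim/big_ind: _ => // i _; apply: QM. Qed.

Lemma ideal_powM k l x y : ideal_pow I k x -> ideal_pow I l y -> ideal_pow I (k + l) (x * y).
Proof.
move=> Ix Iy; elim/ideal_pow_ind: Ix => [|x1 x2 h1 h2|a f If].
- by rewrite mul0r; exact: ideal_pow0.
- by rewrite mulrDl; exact: ideal_powD.
elim/ideal_pow_ind: Iy => [|y1 y2 h1 h2|b g Ig].
- by rewrite mulr0; exact: ideal_pow0.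
- by rewrite mulrDr; exact: ideal_powD.
rewrite mulrACA; apply: ideal_powMl.
pose h i := match split i with inl i => f i | inr i => g i end.
have -> : (\prod_j f j) * (\prod_j g j) = \prod_j h j.
  rewrite big_split_ord /=; congr (_ * _); apply: eq_bigr => i _.
    by rewrite /h (unsplitK (inl i : 'I_k + 'I_l)).
  by rewrite /h (unsplitK (inr i : 'I_k + 'I_l)).
by apply: ideal_pow_prod => i; rewrite /h; case: (split i).
Qed.

Lemma ideal_pow0E x : ideal_pow I 0 x.
Proof.
exists 1%N, (fun _ => x), (fun _ _ => 0); split=> [? []//|].
by rewrite big_ord1 big_ord0 mulr1.
Qed.

Lemma ideal_powS k x : ideal_pow I k.+1 x -> ideal_pow I k x.
Proof.
elim/ideal_pow_ind => [|x1 x2 h1 h2|a f If]; first exact: ideal_pow0.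
  exact: ideal_powD.
by rewrite big_ord_recl mulrA; apply/ideal_powMl/ideal_pow_prod.
Qed.

Lemma ideal_pow1 x : I x -> ideal_pow I 1 x.
Proof. by move=> Ix; have := @ideal_pow_prod 1 (fun _ => x) (fun _ => Ix); rewrite big_ord1. Qed.

End IdealPowers.

Section Spans.
Variables (K : fieldType) (A : comPzRingType) (kc : {rmorphism K -> A}).
Implicit Types (G H : A -> Prop) (x y : A).

Inductive lin_span G : A -> Prop :=
| span_zero : lin_span G 0
| span_cons c g x : G g -> lin_span G x -> lin_span G (kc c * g + x).

Lemma spanD G x y : lin_span G x -> lin_span G y -> lin_span G (x + y).
Proof.
by move=> Gx Gy; elim: Gx => [|c g z Gg _ IH]; rewrite ?add0r // -addrA; apply: span_cons.
Qed.

Lemma spanZ G c x : lin_span G x -> lin_span G (kc c * x).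
Proof.
elim=> [|c' g z Gg _ IH]; first by rewrite mulr0; exact: span_zero.
by rewrite mulrDr mulrA -rmorphM; apply: span_cons.
Qed.

Lemma spanN G x : lin_span G x -> lin_span G (- x).
Proof. by move=> /(spanZ (-1)); rewrite rmorphN1 mulN1r. Qed.

Lemma span_gen G x : G x -> lin_span G x.
Proof.
by move=> Gx; rewrite -[x]addr0 -[x]mul1r -(rmorph1 kc); apply: span_cons (span_zero _).
Qed.

Lemma span_sum G (J : Type) (s : seq J) (P : pred J) (F : J -> A) :
  (forall i, P i -> lin_span G (F i)) -> lin_span G (\sum_(i <- s | P i) F i).
Proof.
by move=> h; elim/big_ind: _ => //; [exact: span_zero | move=> x y; exact: spanD].
Qed.

Lemma span_bind G H x : (forall g, G g -> lin_span H g) -> lin_span G x -> lin_span H x.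
Proof.
move=> GH; elim=> [|c g z /GH Hg _ IH]; first exact: span_zero.
by apply: spanD IH; apply: spanZ.
Qed.

Lemma span_sub_ideal (I : A -> Prop) k G x :
  (forall g, G g -> ideal_pow I k g) -> lin_span G x -> ideal_pow I k x.
Proof.
move=> GI; elim=> [|c g z /GI Ig _ IH]; first exact: ideal_pow0.
by apply: ideal_powD IH; apply: ideal_powMl.
Qed.

Lemma spanM G H J x y : (forall g h, G g -> H h -> J (g * h)) ->
  lin_span G x -> lin_span H y -> lin_span J (x * y).
Proof.
move=> GHJ Gx Hy; elim: Gx => [|c g z Gg _ IH]; first by rewrite mul0r; exact: span_zero.
rewrite mulrDl; apply: spanD IH; rewrite -mulrA; apply: spanZ.
elim: Hy => [|c' h t Hh _ IH]; first by rewrite mulr0; exact: span_zero.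
rewrite mulrDr; apply: spanD IH; rewrite mulrCA; apply: spanZ; apply: span_gen; exact: GHJ.
Qed.

Section Leading.
Variables (B : Type) (xs : B -> A) (I : A -> Prop).
Hypothesis xsI : forall b, I (xs b).

Definition mono (s : seq B) : A := \prod_(b <- s) xs b.

Definition monos k x : Prop := exists2 s, size s = k & x = mono s.

(** The class of x modulo the next power of I is a form of degree k in the
    generators xs. *)
Definition graded k x : Prop := exists2 y, lin_span (monos k) y & ideal_pow I k.+1 (x - y).

(** x agrees modulo I^2 with a polynomial of degree at most 1 in xs whose constant
    term is c.  Keeping track of c makes this relation multiplicative, so that
    it can be evaluated on whole determinants. *)
Definition affine x (c : K) : Prop := graded 1 (x - kc c).

Lemma monosM k l x y : monos k x -> monos l y -> monos (k + l) (x * y).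
Proof.
move=> [s ss ->] [t st ->]; exists (s ++ t); first by rewrite size_cat ss st.
by rewrite /mono big_cat.
Qed.

Lemma monos_ideal k x : monos k x -> ideal_pow I k x.
Proof.
move=> [s + ->]; elim: s k => [_ <-|b s IHs _ <-]; first exact: ideal_pow0E.
rewrite /mono big_cons -[size _]/(1 + size s)%N; apply: ideal_powM; last exact: IHs.
exact: ideal_pow1.
Qed.

Lemma graded_ideal k x : graded k x -> ideal_pow I k x.
Proof.
case=> y sy; rewrite -{2}(subrK y x) => h; apply: ideal_powD; first exact: ideal_powS.
by apply: span_sub_ideal sy => g; exact: monos_ideal.
Qed.

Lemma ideal_graded k x : ideal_pow I k.+1 x -> graded k x.
Proof. by exists 0; [exact: span_zero | rewrite subr0]. Qed.

Lemma gradedD k x y : graded k x -> graded k y -> graded k (x + y).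
Proof.
move=> [x1 sx hx] [y1 sy hy]; exists (x1 + y1); first exact: spanD.
by rewrite opprD addrACA; exact: ideal_powD.
Qed.

Lemma gradedZ k c x : graded k x -> graded k (kc c * x).
Proof.
by move=> [y sy h]; exists (kc c * y); rewrite -?mulrBr; [exact: spanZ | exact: ideal_powMl].
Qed.

Lemma gradedM k l x y : graded k x -> graded l y -> graded (k + l) (x * y).
Proof.
move=> gx gy; have Iy := graded_ideal gy; move: gx gy => [x1 sx hx] [y1 sy hy].
exists (x1 * y1); first exact: spanM (@monosM k l) sx sy.
have -> : x * y - x1 * y1 = (x - x1) * y + x1 * (y - y1) by ring.
apply: ideal_powD; first by rewrite -addSn; exact: ideal_powM.
rewrite -addnS; apply: ideal_powM => //.
by apply: span_sub_ideal sx => g; exact: monos_ideal.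
Qed.

Lemma affine_const c : affine (kc c) c.
Proof. by rewrite /affine subrr; apply: ideal_graded; exact: ideal_pow0. Qed.

Lemma affineD x y c d : affine x c -> affine y d -> affine (x + y) (c + d).
Proof. by rewrite /affine rmorphD opprD addrACA; exact: gradedD. Qed.

Lemma affineM x y c d : affine x c -> affine y d -> affine (x * y) (c * d).
Proof.
move=> hx hy; rewrite /affine rmorphM.
have -> : x * y - kc c * kc d = (x - kc c) * (y - kc d) + (kc c * (y - kc d) + kc d * (x - kc c)).
  by ring.
apply: gradedD; last by apply: gradedD; exact: gradedZ.
by apply: ideal_graded; apply: (@ideal_powM _ _ 1 1); exact: graded_ideal.
Qed.

(** For x = c + u and x y = 1 one has y = c^-1 - c^-2 u + c^-2 y u^2, and u^2 lies
    in I^2. *)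
Lemma affineV x y c : c != 0 -> x * y = 1 -> affine x c -> affine y c^-1.
Proof.
move=> c0 xy hx; rewrite /affine.
have cV : kc c * kc c^-1 = 1 by rewrite -rmorphM divff ?rmorph1.
have -> : y - kc c^-1 = kc (- (c^-1 * c^-1)) * (x - kc c)
     + kc c^-1 * kc c^-1 * y * ((x - kc c) * (x - kc c)).
  rewrite rmorphN rmorphM; set e := kc c^-1 in cV *; set k := kc c in cV *.
  transitivity (y - e + (e * e * x - (e * e * k) *+ 2) * (x * y - 1)
                + ((k * e + 1) * y - e) * (k * e - 1)); last by ring.
  by rewrite xy cV !subrr !mulr0 !addr0.
apply: gradedD; first exact: gradedZ.
apply/ideal_graded/ideal_powMl; apply: (@ideal_powM _ _ 1 1); exact: graded_ideal.
Qed.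

Lemma affine_sum (J : Type) (s : seq J) (P : pred J) (F : J -> A) (f : J -> K) :
  (forall i, P i -> affine (F i) (f i)) ->
  affine (\sum_(i <- s | P i) F i) (\sum_(i <- s | P i) f i).
Proof.
move=> h; apply: (big_ind2 affine) => //; last by move=> *; exact: affineD.
by rewrite -(rmorph0 kc); exact: affine_const.
Qed.

Lemma affineX x c k : affine x c -> affine (x ^+ k) (c ^+ k).
Proof.
move=> h; elim: k => [|k IHk]; last by rewrite !exprS; exact: affineM.
by rewrite !expr0 -(rmorph1 kc); exact: affine_const.
Qed.

Lemma affine_prod (J : Type) (s : seq J) (P : pred J) (F : J -> A) (f : J -> K) :
  (forall i, P i -> affine (F i) (f i)) ->
  affine (\prod_(i <- s | P i) F i) (\prod_(i <- s | P i) f i).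
Proof.
move=> h; apply: (big_ind2 affine) => //; last by move=> *; exact: affineM.
by rewrite -(rmorph1 kc); exact: affine_const.
Qed.

Lemma affine_det k (M : 'M[A]_k) (M0 : 'M[K]_k) :
  (forall i j, affine (M i j) (M0 i j)) -> affine (\det M) (\det M0).
Proof.
move=> h; apply: affine_sum => s _; apply: affineM; last by apply: affine_prod => i _.
by rewrite -(rmorph_sign kc); exact: affine_const.
Qed.

Lemma affine_gen b : affine (xs b) 0.
Proof.
rewrite /affine rmorph0 subr0; exists (xs b); last by rewrite subrr; exact: ideal_pow0.
by apply: span_gen; exists [:: b]; rewrite // /mono big_seq1.
Qed.

Lemma graded_ideal_pow : (forall x, exists c, affine x c) -> (forall x, I x -> affine x 0) ->
  forall k x, ideal_pow I k x -> graded k x.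
Proof.
move=> aff affI k x; elim/ideal_pow_ind => [|x1 x2 h1 h2|a f If].
- exact/ideal_graded/ideal_pow0.
- exact: gradedD.
apply: (@gradedM 0 k).
  have [c /graded_ideal h] := aff a; exists (kc c); last exact: h.
  by rewrite -[kc c]mulr1; apply/spanZ/span_gen; exists [::]; rewrite // /mono big_nil.
elim: k f If => [|k IHk] f If.
  rewrite big_ord0; exists 1; last by rewrite subrr; exact: ideal_pow0.
  by apply: span_gen; exists [::]; rewrite // /mono big_nil.
rewrite big_ord_recl; apply: (@gradedM 1 k); last exact: IHk.
by have := affI _ (If ord0); rewrite /affine rmorph0 subr0.
Qed.

End Leading.
End Spans.

(** * Straightening by minors *)

Lemma perm_inversion r (s : 'S_r) : s != 1%g -> exists k l : 'I_r, (k < l)%N /\ (s l < s k)%N.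
Proof.
move=> s1; have [k0 sk0] : exists k, s k != k.
  apply/existsP; apply: contraR s1 => /existsPn h; apply/eqP/permP => k.
  by rewrite perm1; apply/eqP; have := h k; rewrite negbK.
case: (arg_minnP (fun k : 'I_r => k : nat) (i0 := k0) (P := fun k => s k != k) sk0) => k sk kmin.
have fix_lt (j : 'I_r) : (j < k)%N -> s j = j.
  by move=> jk; apply/eqP; apply: contraLR jk => /kmin; rewrite -leqNgt.
exists k, ((s^-1)%g k); rewrite permKV; split.
  rewrite ltnNge leq_eqVlt negb_or; apply/andP; split.
    by apply: contra sk => /eqP/val_inj e; rewrite -{1}e permKV.
  by apply/negP => h; have := fix_lt _ h; rewrite permKV => e; rewrite -e ltnn in h.
rewrite ltnNge leq_eqVlt negb_or val_eqE sk /=; apply/negP => /fix_lt /perm_inj e.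
by rewrite e eqxx in sk.
Qed.

(** Undoing an inversion increases the sum strictly, so a permutation with maximal
    sum has no inversion and is the identity. *)
Lemma rearrangement r (p q : 'I_r -> nat) (s : 'S_r) :
  {homo p : k l / (k < l)%N} -> {homo q : k l / (k < l)%N} -> s != 1%g ->
  (\sum_k p k * q (s k) < \sum_k p k * q k)%N.
Proof.
move=> p_inc q_inc.
pose F (s : 'S_r) := (\sum_k p k * q (s k))%N.
have incr (u : 'S_r) : u != 1%g -> exists u', (F u < F u')%N.
  case/perm_inversion => k [l [kl ukl]]; exists (tperm k l * u)%g.
  have lk : l != k by apply: contraTneq kl => ->; rewrite ltnn.
  rewrite /F (bigD1 k) //= (bigD1 l) //= [X in (_ < X)%N](bigD1 k) //= [X in (_ < _ + X)%N](bigD1 l) //=.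
  rewrite !permM tpermL tpermR !addnA.
  have -> : (\sum_(i < r | (i != k) && (i != l)) p i * q ((tperm k l * u)%g i) =
             \sum_(i < r | (i != k) && (i != l)) p i * q (u i))%N.
    by apply: eq_bigr => i /andP[ik il]; rewrite permM tpermD // eq_sym.
  rewrite ltn_add2r; have := p_inc _ _ kl; have := q_inc _ _ ukl; nia.
case: (@arg_maxnP _ 1%g xpredT F isT) => u _ umax s1.
have [s' lt] := incr _ s1.
have u1 : u = 1%g.
  apply/eqP; apply: contraT => /incr[u']; rewrite ltnNge => /negP[]; exact: umax.
apply: leq_trans lt _; apply: leq_trans (umax s' isT) _.
by rewrite u1 /F; apply: leq_sum => k _; rewrite perm1.
Qed.

Lemma perm_cat_sub (T : eqType) (C S : seq T) : uniq C -> {subset C <= S} ->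
  exists S', perm_eq S (C ++ S').
Proof.
elim: C S => [|x C IHC] S /=; first by exists S.
case/andP=> xC uC sub; have xS : x \in S by apply: sub; rewrite mem_head.
have pS := perm_to_rem xS.
have [|S' pS'] := IHC (rem x S) uC; last first.
  by exists S'; apply: perm_trans pS _; rewrite perm_cons.
move=> y yC; have : y \in S by apply: sub; rewrite in_cons yC orbT.
by rewrite (perm_mem pS) in_cons => /orP[/eqP e|//]; rewrite -e yC in xC.
Qed.

Section Mix.
Variables (n d : nat).
Implicit Types (a b : proot n d).
Local Notation row b := (brow b).
Local Notation col b := (bcol b).

Lemma mix_subproof a b : ((col a, row b).1 < d <= (col a, row b).2)%N.
Proof. by have [-> _] := box_bounds a; have [_] := box_bounds b. Qed.

Definition mix a b : proot n d := Sub (col a, row b) (mix_subproof a b).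

Lemma col_mix a b : col (mix a b) = col a. Proof. by rewrite /bcol SubK. Qed.
Lemma row_mix a b : row (mix a b) = row b. Proof. by rewrite /brow SubK. Qed.

End Mix.

(** Here x is any family of elements of a K-algebra such that the minors along the
    chains exceeding the rank bound vanish. *)
Section Straightening.
Variables (K : fieldType) (A : comPzRingType) (kc : {rmorphism K -> A}).
Variables (n d : nat) (le_dn : (d <= n)%N) (w : 'I_d -> 'I_n) (x : proot n d -> A).
Implicit Types (a b : proot n d) (C S : seq (proot n d)).
Local Notation W := (widen_ord le_dn).
Local Notation row b := (brow b).
Local Notation col b := (bcol b).
Local Notation mono := (mono x).

Hypothesis minor_vanish : forall q C, sorted (@box_lt n d) C -> all (in_rect 1 q) C ->
  (count_below W q < size C + count_below w q)%N ->
  \det (\matrix_(k, l) x (mix (tnth (in_tuple C) k) (tnth (in_tuple C) l))) = 0.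

(** Columns increase and rows decrease along a chain, hence both factors increase,
    and the diagonal of a minor has the largest weight among the terms of its
    expansion. *)
Definition weight S : nat := (\sum_(b <- S) col b * (n - row b))%N.

Definition admissible_monos m (g : A) : Prop :=
  exists S, [/\ size S = m, admissible le_dn 1 w (fun b => count_mem b S) & g = mono S].

Lemma bad_chain S : ~ admissible le_dn 1 w (fun b => count_mem b S) ->
  exists q C, [/\ sorted (@box_lt n d) C, all (in_rect 1 q) C,
    (count_below W q < size C + count_below w q)%N & {subset C <= S}].
Proof.
move=> ng; apply/not_existsP => no; apply: ng => q C sC aC.
have -> : count_below ((1 : 'S_n)%g \o W) q = count_below W q by apply: eq_bigr => t _; rewrite /= perm1.
rewrite leqNgt; apply/negP => h; apply: (no q); exists C; split=> //.
- by apply: sub_all aC => b /andP[].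
- by move=> b /(allP aC) /andP[]; rewrite -has_count has_pred1.
Qed.

(** Induction on the weight: the minor along a forbidden chain expresses the product
    of its diagonal through the products for the other permutations. *)
Lemma straighten S : lin_span kc (admissible_monos (size S)) (mono S).
Proof.
have [N] := ubnP (weight S).
elim: N S => // N IHN S ltN.
have [gS|/bad_chain[q [C [sC aC big sub]]]] := pselect (admissible le_dn 1 w (fun b => count_mem b S)).
  by apply: span_gen; exists S.
have irr : irreflexive (@box_lt n d) by move=> b; rewrite /box_lt ltnn.
have [S' pS] := perm_cat_sub (sorted_uniq (@box_lt_trans n d) irr sC) sub.
set r := size C; pose c (k : 'I_r) := tnth (in_tuple C) k.
pose mixed (s : 'S_r) := [seq mix (c k) (c (s k)) | k <- enum 'I_r] ++ S'.
have mono_mixed s : mono (mixed s) = (\prod_k x (mix (c k) (c (s k)))) * mono S'.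
  rewrite /mono big_cat /= big_map big_enum; congr (_ * _); apply: eq_bigr => k _.
have weight_mixed s : weight (mixed s) =
    ((\sum_k col (c k) * (n - row (c (s k)))) + weight S')%N.
  rewrite /weight big_cat /= big_map big_enum; congr (_ + _)%N; apply: eq_bigr => k _.
have size_mixed s : size (mixed s) = size S.
  by rewrite (perm_size pS) !size_cat size_map size_enum_ord.
have mixed1 : perm_eq (mixed 1%g) S.
  rewrite perm_sym; apply: perm_trans pS _; rewrite perm_cat2r.
  have -> : [seq mix (c k) (c ((1 : 'S_r)%g k)) | k <- enum 'I_r] = C; last exact: perm_refl.
  rewrite -[RHS](map_tnth_enum (in_tuple C)); apply: eq_map => k; rewrite perm1.
  by apply/eqP; rewrite box_eqE col_mix row_mix !eqxx.
have c_lt (k l : 'I_r) : (k < l)%N -> box_lt (c k) (c l).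
  move=> kl; rewrite /c !(tnth_nth (c k)) /=.
  by apply: (sorted_ltn_nth (@box_lt_trans n d)); rewrite ?inE.
have lt_weight s : s != 1%g -> (weight (mixed s) < weight S)%N.
  move=> s1; have -> : weight S = weight (mixed 1%g) by apply: perm_big; rewrite perm_sym.
  rewrite !weight_mixed ltn_add2r.
  have -> : (\sum_k col (c k) * (n - row (c ((1 : 'S_r)%g k))) =
             \sum_k col (c k) * (n - row (c k)))%N by apply: eq_bigr => k _; rewrite perm1.
  apply: (rearrangement (p := fun k => col (c k)) (q := fun k => (n - row (c k))%N)) s1.
    by move=> k l /c_lt /andP[].
  by move=> k l /c_lt /andP[_]; have := ltn_ord (row (c k)); lia.
have -> : mono S = - \sum_(s : 'S_r | s != 1%g) (-1) ^+ s * mono (mixed s).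
  apply/eqP; rewrite -addr_eq0.
  have -> : mono S = mono (mixed 1%g) by apply: perm_big; rewrite perm_sym.
  have := minor_vanish sC aC big; rewrite /determinant (bigD1 1%g) //=.
  move=> /(congr1 (fun z => z * mono S')); rewrite mul0r mulrDl => h.
  apply/eqP; rewrite -[RHS]h; congr (_ + _).
    by rewrite odd_perm1 mul1r mono_mixed; congr (_ * _); apply: eq_bigr => k _; rewrite !mxE.
  rewrite mulr_suml; apply: eq_bigr => s _; rewrite mono_mixed mulrA; congr (_ * _ * _).
  by apply: eq_bigr => k _; rewrite !mxE.
apply/spanN/span_sum => s s1; rewrite -(rmorph_sign kc); apply: spanZ.
rewrite -(size_mixed s); apply: IHN.
by apply: leq_trans (lt_weight _ s1) _.
Qed.

End Straightening.

(** * Minors on a cell *)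

Section Minors.
Variables (n d : nat) (le_dn : (d <= n)%N).
Implicit Types (w u : Idn n d) (b : proot n d) (C : seq (proot n d)).
Local Notation W := (widen_ord le_dn).
Local Notation row b := (brow b).
Local Notation col b := (bcol b).
Local Notation idn := (coset_Idn le_dn 1%g).

Definition minor (T : comPzRingType) (f : 'I_d -> 'I_n) (M : 'M[T]_(n, d)) : T :=
  \det (\matrix_(s, t) M (f s) t).

Lemma minor_mulmx (T : comPzRingType) f (M : 'M[T]_(n, d)) g :
  minor f (M *m g) = minor f M * \det g.
Proof.
rewrite /minor -det_mulmx; congr (\det _); apply/matrixP => s t; rewrite !mxE.
by apply: eq_bigr => k _; rewrite !mxE.
Qed.

Lemma tnth_idn t : tnth (val idn) t = W t.
Proof.
have h q : (tnth (val idn) t < q)%N = (W t < q)%N.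
  rewrite ltn_count_below count_below_coset.
  have -> : count_below ((1 : 'S_n)%g \o W) q = minn q d.
    by rewrite -sum_ltn_ord; apply: eq_bigr => s _; rewrite /= perm1.
  by have := ltn_ord t; rewrite /=; lia.
apply: val_inj => /=; have := h (tnth (val idn) t); have := h (W t).
by rewrite !ltnn /=; lia.
Qed.

Lemma chart1E (T : pzRingType) (X : 'I_n -> 'I_n -> T) k j :
  chart le_dn 1 X k j = if (k < d)%N then (k == W j)%:R else X (W j) k.
Proof.
rewrite mxE invg1 !perm1; cbv zeta; case: (ltnP k d) => // dk.
by rewrite (leq_trans _ dk) //= ltn_ord.
Qed.

Lemma minor_idn (T : comPzRingType) (X : 'I_n -> 'I_n -> T) :
  minor (tnth (val idn)) (chart le_dn 1 X) = 1.
Proof.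
rewrite /minor -(det1 T d); congr (\det _); apply/matrixP => s t.
rewrite !mxE -/(chart le_dn 1 X _ _) tnth_idn.
have := chart1E X (W s) t; rewrite mxE => ->.
by rewrite /= ltn_ord -val_eqE.
Qed.

(** Sorting the selected rows only changes the sign of the minor, by a sign that
    depends on the permutation alone. *)
Lemma minor_coset (s : 'S_n) : exists e : bool, forall (T : comPzRingType) (M : 'M[T]_(n, d)),
  minor (tnth (val (coset_Idn le_dn s))) M = (-1) ^+ e * minor (s \o W) M.
Proof.
have /tuple_permP[p pE] : perm_eq (val (coset_Idn le_dn s)) [tuple s (W t) | t < d].
  by rewrite /= perm_sort.
exists (odd_perm p) => T M; rewrite -det_perm -det_mulmx -row_permE; congr (\det _).
apply/matrixP => i j; rewrite !mxE; congr (M _ _).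
have x0 := s (W i).
by rewrite (tnth_nth x0) pE (nth_map i) ?size_enum_ord // nth_ord_enum !tnth_map !tnth_ord_tuple.
Qed.

(** All selected rows but one are unit vectors, so only the identity contributes to
    the Leibniz formula. *)
Lemma minor_refl (T : comPzRingType) (X : 'I_n -> 'I_n -> T) b :
  minor (refl_of b \o W) (chart le_dn 1 X) = X (col b) (row b).
Proof.
have [tc tcE] := colW le_dn b; have [bd db] := box_bounds b.
have row_other t : t != tc -> refl_of b (W t) = W t.
  move=> ne; rewrite /refl_of tpermD //; rewrite -/(bcol b) -/(brow b).
    by rewrite -tcE; apply: contra ne => /eqP/(congr1 val) /= /val_inj->.
  by apply/eqP => e; have := ltn_ord t; move: db; rewrite e /=; lia.
rewrite /minor /determinant (bigD1 1%g) //= odd_perm1 mul1r (bigD1 tc) //=.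
rewrite mxE chart1E /= tcE /refl_of tpermL -/(brow b) ltnNge db perm1 tcE /=.
rewrite [X in _ * X]big1 ?mulr1 => [|t ne]; last first.
  by rewrite mxE chart1E /= row_other //= ltn_ord perm1 eqxx.
rewrite big1 ?addr0 // => s s1.
have [t ne st] : exists2 t, t != tc & s t != t.
  apply/exists_inP; apply: contraR s1; rewrite negb_exists_in => /forall_inP h.
  have fix_other t : t != tc -> s t = t by move=> /h; rewrite negbK => /eqP.
  apply/eqP/permP => t; rewrite perm1; have [->|/fix_other//] := eqVneq t tc.
  apply/eqP; apply: contraT => ne; have := fix_other _ ne => /perm_inj e.
  by rewrite e eqxx in ne.
rewrite [X in _ * X](bigD1 t) //= mxE chart1E /= row_other //= ltn_ord.
have -> : (W t == W (s t)) = false.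
  by apply/negbTE; apply: contra st => /eqP/(congr1 val) /= /val_inj <-.
by rewrite mul0r mulr0.
Qed.

Section CellMinors.
Variables (K : fieldType) (w : 'I_d -> 'I_n).
Implicit Types (M : 'M[K]_(n, d)).

(** A nonzero Leibniz term would give a permutation s with f t <= w (s t) for all t,
    against the inequality of the counts below q. *)
Lemma minor_cell_eq0 (f : 'I_d -> 'I_n) q M : (count_below f q < count_below w q)%N ->
  in_cell w M -> minor f M = 0.
Proof.
move=> lt [b [g [[ub _] _ ->]]]; rewrite minor_mulmx.
suff -> : minor f (b *m coord_mx K w) = 0 by rewrite mul0r.
rewrite /minor /determinant big1 // => s _.
have bE i t : (b *m coord_mx K w) i t = b i (w t).
  rewrite mxE (bigD1 (w t)) //= mxE eqxx mulr1 big1 ?addr0 // => k ne.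
  by rewrite mxE (negbTE ne) mulr0.
have [t wt] : exists t, (w (s t) < f t)%N.
  apply/existsP; apply: contraLR lt => /existsPn h; rewrite -leqNgt.
  rewrite /count_below (reindex_inj (@perm_inj _ s)) /=; apply: leq_sum => t _.
  by have := h t; lia.
by rewrite [X in _ * X](bigD1 t) //= mxE bE ub // mul0r mulr0.
Qed.

(** Complete the rows of the chain by unit vectors at the remaining pivots.  By
    [minor_cell_eq0] the resulting d x d matrix is singular, and a vector in its
    kernel is supported on the columns of the chain, where it is killed by the
    r x r block. *)
Lemma chain_minor_eq0 q C (X : 'I_n -> 'I_n -> K) :
  sorted (@box_lt n d) C -> all (in_rect 1 q) C -> (count_below W q < size C + count_below w q)%N ->
  in_cell w (chart le_dn 1 X) ->
  \det (\matrix_(k, l) X (col (tnth (in_tuple C) k)) (row (tnth (in_tuple C) l))) = 0.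
Proof.
move=> sC aC big cX; set r := size C in big *; pose c (k : 'I_r) := tnth (in_tuple C) k.
have irr : irreflexive (@box_lt n d) by move=> b; rewrite /box_lt ltnn.
have c_lt (k l : 'I_r) : (k < l)%N -> box_lt (c k) (c l).
  move=> kl; rewrite /c !(tnth_nth (c k)) /=.
  by apply: (sorted_ltn_nth (@box_lt_trans n d)); rewrite ?inE.
pose cc k := Ordinal (proj1 (box_bounds (c k))).
have ccE k : W (cc k) = col (c k) by exact: val_inj.
have cc_inj : injective cc.
  move=> k l /(congr1 val) /= e; apply: val_inj => /=.
  have := @c_lt k l; have := @c_lt l k; rewrite /box_lt /= e; lia.
pose f t := if [pick k | cc k == t] is Some k then row (c k) else W t.
have f_cc k : f (cc k) = row (c k).
  by rewrite /f; case: pickP => [l /eqP/cc_inj->//|/(_ k)]; rewrite eqxx.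
have f_other t : t \notin codom cc -> f t = W t.
  by move=> h; rewrite /f; case: pickP => // k /eqP e; rewrite -e codom_f in h.
have c_rect k : in_rect 1 q (c k) by apply: (allP aC); apply: mem_tnth.
have lt_count : (count_below f q < count_below w q)%N.
  suff : (count_below f q + r <= count_below W q)%N by lia.
  have <- : (\sum_(t < d) (t \in codom cc) = r)%N.
    rewrite -[RHS]card_ord -(card_codom cc_inj) -sum1_card [RHS]big_mkcond /=.
    by apply: eq_bigr => t _; case: (t \in _).
  rewrite /count_below -big_split /=; apply: leq_sum => t _.
  case: (boolP (t \in codom cc)) => [/codomP[k ->]|h]; last by rewrite addn0 f_other.
  by rewrite f_cc; have := c_rect k; rewrite /in_rect !perm1 -ccE /=; lia.
have /eqP := minor_cell_eq0 lt_count cX; rewrite /minor -det_tr => /det0P[v v0 vM].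
have vE s : \sum_t v 0 t * chart le_dn 1 X (f s) t = 0.
  have := congr1 (fun M : 'rV[K]_d => M 0 s) vM; rewrite !mxE => h; rewrite -[RHS]h.
  by apply: eq_bigr => t _; rewrite !mxE.
have v_other t : t \notin codom cc -> v 0 t = 0.
  move=> h; have := vE t; rewrite f_other // (bigD1 t) //= chart1E /= ltn_ord eqxx mulr1.
  rewrite big1 ?addr0 // => s ne; rewrite chart1E /= ltn_ord.
  have -> : (W t == W s) = false.
    by apply/negbTE; apply: contra ne => /eqP/(congr1 val) /= /val_inj ->.
  by rewrite mulr0.
have sum_cc (F : 'I_d -> K) : \sum_t v 0 t * F t = \sum_k v 0 (cc k) * F (cc k).
  have <- : \sum_(t in cc @: setT) v 0 t * F t = \sum_k v 0 (cc k) * F (cc k).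
    rewrite big_imset /=; last by move=> k l _ _ /cc_inj.
    by apply: eq_bigl => k; rewrite inE.
  rewrite [LHS](bigID (mem (cc @: setT))) /= [X in _ + X]big1 ?addr0 // => t h.
  rewrite v_other ?mul0r //; apply: contra h => /codomP[k ->].
  by apply: imset_f; rewrite inE.
apply/eqP/det0P; exists (\row_k v 0 (cc k)).
  apply: contra v0 => /eqP u0; apply/eqP/rowP => t; rewrite [RHS]mxE.
  case: (boolP (t \in codom cc)) => [/codomP[k ->]|]; last exact: v_other.
  by have := congr1 (fun M : 'rV[K]_r => M 0 k) u0; rewrite !mxE.
apply/rowP => l; rewrite mxE [RHS]mxE -[RHS](vE (cc l)) sum_cc; apply: eq_bigr => k _.
rewrite f_cc chart1E ccE ifN ?mxE // -leqNgt.
by have [] := box_bounds (c l).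
Qed.

End CellMinors.

End Minors.

(** * The chart of a Schubert variety at the identity point *)

Local Notation "x %:F" := (FracField.tofrac x).

Section Orbit.
Variables (K : closedFieldType) (n d : nat) (le_dn : (d <= n)%N).
Implicit Types (w u : Idn n d) (b : proot n d) (X : 'I_n -> 'I_n -> K).
Local Notation W := (widen_ord le_dn).
Local Notation N := #|{: Idn n d}|.
Local Notation idn := (coset_Idn le_dn 1%g).

Definition pt X : 'rV[K]_N := wedge (chart le_dn 1 X).

Definition id_index : 'I_N := enum_rank idn.

Lemma wedgeE (M : 'M[K]_(n, d)) i : wedge M 0 i = minor (tnth (val (enum_val i))) M.
Proof. by rewrite mxE. Qed.

Lemma wedge_mulmx (M : 'M[K]_(n, d)) g : wedge (M *m g) = \det g *: wedge M.
Proof. by apply/rowP => i; rewrite [RHS]mxE !wedgeE minor_mulmx mulrC. Qed.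

Lemma pt_id X : pt X 0 id_index = 1.
Proof. by rewrite wedgeE enum_rankK minor_idn. Qed.

Lemma det_upper (b : 'M[K]_n) : (forall i j : 'I_n, (j < i)%N -> b i j = 0) ->
  \det b = \prod_i b i i.
Proof.
move=> ub; rewrite -det_tr det_trig; first by apply: eq_bigr => i _; rewrite mxE.
by apply/is_trig_mxP => i j ij; rewrite mxE ub.
Qed.

Lemma id_pointE : id_point K le_dn = pt (fun _ _ => 0).
Proof.
apply/rowP => i; rewrite !wedgeE; congr (minor _ _); apply/matrixP => k j.
rewrite mxE tnth_idn chart1E; case: ltnP => // dk.
by case: eqP => // e; move: dk; rewrite e /= leqNgt ltn_ord.
Qed.

(** The upper triangular factor is brought into SL_n by dividing it by an n-th root
    of its determinant; the homogeneous coordinates change by a scalar. *)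
Lemma cell_orbit w (M : 'M[K]_(n, d)) : (0 < n)%N -> in_cell (tnth (val w)) M -> borel_orbit w (wedge M).
Proof.
move=> n0 [b [g [[ub db] ug ->]]].
have d0 : \det b != 0 by rewrite det_upper //; apply/prodf_neq0 => i _.
have [nu nuE] : exists nu : K, nu ^+ n = \det b.
  move: (\det b) => a; have [nu] := @solve_monicpoly K n (fun i => if i == 0%N then a else 0) n0.
  rewrite -(prednK n0) big_ord_recl /= mulr1 big1 ?addr0 => [e|i _]; first by exists nu; rewrite -(prednK n0).
  by rewrite mul0r.
have nu0 : nu != 0 by apply: contraNneq d0 => e; rewrite -nuE e expr0n eqn0Ngt n0.
exists (nu^-1 *: b), (\det (nu *: g)); split.
- split; first by rewrite detZ exprVn nuE mulVf.
  by move=> i j ji; rewrite mxE ub ?mulr0.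
- by rewrite detZ mulf_neq0 ?expf_neq0 //; rewrite -unitfE -unitmxE.
- rewrite -wedge_mulmx; congr (wedge _).
  by rewrite -!scalemxAl -scalemxAr scalerA mulVf // scale1r.
Qed.

(** The coordinate of the identity point is the minor of the top d rows; when it
    does not vanish, that block is inverted to normalize the matrix. *)
Lemma orbit_chart w (v : 'rV[K]_N) : borel_orbit w v -> v 0 id_index != 0 ->
  exists X c, [/\ c != 0, in_cell (tnth (val w)) (chart le_dn 1 X) & v = c *: pt X].
Proof.
move=> [b [c [[db ub] c0 ->]]]; set M := b *m basis_mx K w; rewrite mxE wedgeE enum_rankK => nz.
pose T : 'M[K]_d := \matrix_(s, t) M (tnth (val idn) s) t.
have T0 : \det T != 0 by apply: contraNneq nz => e; rewrite /minor -/T e mulr0.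
have uT : T \in unitmx by rewrite unitmxE unitfE.
pose M' := M *m invmx T.
pose X (j k : 'I_n) := if insub (val j) is Some t then M' k t else 0.
have M'E : chart le_dn 1 X = M'.
  apply/matrixP => k j; rewrite chart1E /X /= insubT //= => jd.
  case: ltnP => kd; last by congr (M' _ _); exact: val_inj.
  have -> : k = W (Ordinal kd) by exact: val_inj.
  have TT : T *m invmx T = 1%:M by rewrite mulmxV.
  have := congr1 (fun A : 'M[K]_d => A (Ordinal kd) j) TT; rewrite [RHS]mxE.
  rewrite -val_eqE /= -val_eqE /= => <-; rewrite !mxE; apply: eq_bigr => s _.
  by rewrite mxE tnth_idn.
exists X, (c * \det T); split.
- by rewrite mulf_neq0.
- rewrite M'E; exists b, (invmx T); split=> //; last by rewrite unitmx_inv.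
  split=> // i; have := oner_neq0 K; rewrite -db det_upper // => /prodf_neq0; exact.
- rewrite -scalerA /pt M'E -wedge_mulmx /M' -mulmxA mulVmx // mulmx1 //.
Qed.

End Orbit.

(** * Regular functions on the chart and the local ring *)

Section LocalRing.
Variables (K : closedFieldType) (n d : nat) (le_dn : (d <= n)%N) (w : Idn n d).
Implicit Types (u : Idn n d) (b : proot n d) (X : 'I_n -> 'I_n -> K).
Local Notation W := (widen_ord le_dn).
Local Notation row b := (brow b).
Local Notation col b := (bcol b).
Local Notation N := #|{: Idn n d}|.
Local Notation P := (id_point K le_dn).
Local Notation R := (proj_local_ring P).
Local Notation A := (local_ring (schubert K w) P).
Local Notation pt := (@pt K n d le_dn).
Local Notation i0 := (id_index le_dn).
Local Notation m0 := (fun _ _ => 0 : K).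

Definition to_lr (z : R) : A := \pi_A z.

Lemma to_lr_zmod : zmod_morphism to_lr.
Proof.
move=> x y; apply: (addIr (to_lr y)); rewrite subrK /to_lr.
by rewrite -[in RHS](subrK y x); apply/esym; exact: lr_piD.
Qed.
Lemma to_lr_monoid : monoid_morphism to_lr.
Proof. by split=> // x y; exact: lr_pi_mul. Qed.
HB.instance Definition _ := GRing.isZmodMorphism.Build R A to_lr to_lr_zmod.
HB.instance Definition _ := GRing.isMonoidMorphism.Build R A to_lr to_lr_monoid.

Lemma proj_const_zmod : zmod_morphism (@proj_const K N P).
Proof. by move=> a b; apply: val_inj; rewrite /= mpolyCB tofracB. Qed.
Lemma proj_const_monoid : monoid_morphism (@proj_const K N P).
Proof.
split; first by apply: val_inj; rewrite /= mpolyC1 tofrac1.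
by move=> a b; apply: val_inj; rewrite /= mpolyCM tofracM.
Qed.
HB.instance Definition _ := GRing.isZmodMorphism.Build K R (@proj_const K N P) proj_const_zmod.
HB.instance Definition _ := GRing.isMonoidMorphism.Build K R (@proj_const K N P) proj_const_monoid.

Definition lr_const : K -> A := to_lr \o @proj_const K N P.
HB.instance Definition _ := GRing.RMorphism.on lr_const.

Lemma lr_scaleE (c : K) (x : A) : c *: x = lr_const c * x.
Proof. by []. Qed.

Lemma to_lr_eq0 z : z \in @local_ideal K N (schubert K w) P -> to_lr z = 0.
Proof.
move=> h; rewrite -(rmorph0 to_lr); apply/eqP; rewrite piE Quotient.equivE subr0 //.
Qed.

Lemma to_lr_eq z z' : to_lr z = to_lr z' -> z - z' \in @local_ideal K N (schubert K w) P.
Proof. by move=> /eqP; rewrite piE Quotient.equivE. Qed.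

Lemma Pi0 : P 0 i0 = 1.
Proof. by rewrite id_pointE pt_id. Qed.

(** Restriction to the chart: p_id is 1 at the points [1; X], so f / p_id^k takes
    the value f there.  The relation lets identities in the local ring be checked
    pointwise. *)
Definition restricts_to (z : R) (phi : ('I_n -> 'I_n -> K) -> K) : Prop :=
  exists k f, [/\ f \is k.-homog, val z = f%:F / ('X_i0 ^+ k)%:F &
                  forall X, phi X = f.@[pt X 0]].

Lemma homogXn k : ('X_i0 ^+ k : {mpoly K[N]}) \is k.-homog.
Proof.
have h : ('X_i0 : {mpoly K[N]}) \is 1.-homog by rewrite dhomogX /= mdeg1.
by have := dhomogMn k h; rewrite mul1n.
Qed.

Lemma Xn_neq0 k : ('X_i0 ^+ k : {mpoly K[N]}) != 0.
Proof. by apply/(@meval_neq0 K N P); rewrite rmorphXn /= mevalXU Pi0 expr1n oner_neq0. Qed.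

Lemma meval_Xn k X : ('X_i0 ^+ k : {mpoly K[N]}).@[pt X 0] = 1.
Proof. by rewrite rmorphXn /= mevalXU pt_id expr1n. Qed.

Lemma restricts_ext z phi psi : (forall X, phi X = psi X) ->
  restricts_to z phi -> restricts_to z psi.
Proof. by move=> e [k [f [h v ev]]]; exists k, f; split=> // X; rewrite -e. Qed.

Lemma restricts_const c : restricts_to (proj_const P c) (fun _ => c).
Proof.
exists 0%N, c%:MP; split; last by move=> X; rewrite mevalC.
  by rewrite -[X in X \is _]mulr1 mul_mpolyC; apply: dhomogZ; exact: dhomog1.
by rewrite expr0 tofrac_div1.
Qed.

Lemma restrictsD z z' phi psi : restricts_to z phi -> restricts_to z' psi ->
  restricts_to (z + z') (fun X => phi X + psi X).
Proof.
move=> [k [f [hf vf ef]]] [l [g [hg vg eg]]].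
exists (k + l)%N, (f * 'X_i0 ^+ l + g * 'X_i0 ^+ k); split.
- by apply: rpredD; [|rewrite addnC]; apply: dhomogM => //; exact: homogXn.
- rewrite rmorphD /= vf vg exprD tofracD !tofracM addf_div // ?tofrac_eq0 ?Xn_neq0 //.
- by move=> X; rewrite mevalD !mevalM !meval_Xn !mulr1 ef eg.
Qed.

Lemma restrictsM z z' phi psi : restricts_to z phi -> restricts_to z' psi ->
  restricts_to (z * z') (fun X => phi X * psi X).
Proof.
move=> [k [f [hf vf ef]]] [l [g [hg vg eg]]].
exists (k + l)%N, (f * g); split; first exact: dhomogM.
- by rewrite rmorphM /= vf vg exprD !tofracM mulf_div.
- by move=> X; rewrite mevalM ef eg.
Qed.

Lemma restricts0 : restricts_to 0 (fun _ => 0).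
Proof. by have := restricts_const 0; rewrite (rmorph0 (proj_const P)). Qed.

Lemma restricts1 : restricts_to 1 (fun _ => 1).
Proof. by have := restricts_const 1; rewrite (rmorph1 (proj_const P)). Qed.

Lemma restrictsN z phi : restricts_to z phi -> restricts_to (- z) (fun X => - phi X).
Proof.
move=> h; have := restrictsM (restricts_const (-1)) h.
by rewrite (rmorphN1 (proj_const P)) mulN1r; apply: restricts_ext => X; rewrite mulN1r.
Qed.

Lemma restricts_sum (J : Type) (s : seq J) (Q : pred J) (F : J -> R) phi :
  (forall i, Q i -> restricts_to (F i) (phi i)) ->
  restricts_to (\sum_(i <- s | Q i) F i) (fun X => \sum_(i <- s | Q i) phi i X).
Proof.
move=> h; elim: s => [|i s IHs].
  by rewrite big_nil; apply: restricts_ext restricts0 => X; rewrite big_nil.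
rewrite big_cons; case: ifP => Qi; last by apply: restricts_ext IHs => X; rewrite big_cons Qi.
by apply: restricts_ext (restrictsD (h i Qi) IHs) => X; rewrite big_cons Qi.
Qed.

Lemma restricts_prod (J : Type) (s : seq J) (Q : pred J) (F : J -> R) phi :
  (forall i, Q i -> restricts_to (F i) (phi i)) ->
  restricts_to (\prod_(i <- s | Q i) F i) (fun X => \prod_(i <- s | Q i) phi i X).
Proof.
move=> h; elim: s => [|i s IHs].
  by rewrite big_nil; apply: restricts_ext restricts1 => X; rewrite big_nil.
rewrite big_cons; case: ifP => Qi; last by apply: restricts_ext IHs => X; rewrite big_cons Qi.
by apply: restricts_ext (restrictsM (h i Qi) IHs) => X; rewrite big_cons Qi.
Qed.

Lemma restricts_det k (M : 'M[R]_k) (phi : 'I_k -> 'I_k -> ('I_n -> 'I_n -> K) -> K) :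
  (forall i j, restricts_to (M i j) (phi i j)) ->
  restricts_to (\det M) (fun X => \det (\matrix_(i, j) phi i j X)).
Proof.
move=> h; apply: (@restricts_ext _ (fun X => \sum_(s : 'S_k) (-1) ^+ s * \prod_i phi i (s i) X)).
  by move=> X; apply: eq_bigr => s _; congr (_ * _); apply: eq_bigr => i _; rewrite mxE.
apply: restricts_sum => s _; apply: restrictsM; last by apply: restricts_prod => i _; exact: h.
by rewrite -(rmorph_sign (proj_const P)); exact: restricts_const.
Qed.

Lemma meval_homogZ k (f : {mpoly K[N]}) (c : K) (v : 'rV[K]_N) : f \is k.-homog ->
  f.@[(c *: v) 0] = c ^+ k * f.@[v 0].
Proof.
move=> /dhomogP hf; rewrite !mevalE mulr_sumr !big_seq; apply: eq_bigr => m /hf /= dm.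
rewrite mulrCA; congr (_ * _); rewrite -dm mdegE expr_sum -big_split /=.
by apply: eq_bigr => i _; rewrite mxE exprMn.
Qed.

(** A form that vanishes on the part of the orbit where p_id <> 0 vanishes on all
    of X(w) after multiplication by p_id, which is invertible at the identity
    point. *)
Lemma restricts_vanish z phi : restricts_to z phi ->
  (forall X, in_cell (tnth (val w)) (chart le_dn 1 X) -> phi X = 0) -> to_lr z = 0.
Proof.
move=> [k [f [hf vz ev]]] van; apply: to_lr_eq0; apply/asboolP.
have hF : 'X_i0 * f \is (1 + k).-homog by apply: dhomogM hf; exact: (homogXn 1).
exists (1 + k)%N, ('X_i0 * f), ('X_i0 ^+ (1 + k)); split=> //.
- exact: homogXn.
- by rewrite rmorphXn /= mevalXU Pi0 expr1n oner_neq0.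
- move=> v [_ cl]; apply: cl hF _ => v' ov; rewrite mevalM mevalXU; have [->|nz] := eqVneq (v' 0 i0) 0; first by rewrite mul0r.
  have [X [c [c0 cX ->]]] := orbit_chart ov nz.
  by rewrite (meval_homogZ _ _ hf) -ev van // !mulr0.
- rewrite vz exprD expr1 !tofracM -mulf_div divff ?mul1r // tofrac_eq0.
  by have := Xn_neq0 1.
Qed.

Lemma plucker_subproof (i : 'I_N) : regular_at P (('X_i : {mpoly K[N]})%:F / ('X_i0 : {mpoly K[N]})%:F).
Proof.
apply/asboolP; exists 1%N, 'X_i, 'X_i0; split=> //; rewrite ?dhomogX /= ?mdeg1 //.
by rewrite mevalXU Pi0 oner_neq0.
Qed.
Definition plucker (i : 'I_N) : R := exist _ (('X_i : {mpoly K[N]})%:F / ('X_i0 : {mpoly K[N]})%:F) (plucker_subproof i).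

Lemma restricts_plucker i : restricts_to (plucker i) (fun X => pt X 0 i).
Proof.
exists 1%N, 'X_i; split=> [||X].
- by rewrite dhomogX /= mdeg1.
- by rewrite expr1.
- by rewrite mevalXU.
Qed.

(** * The box coordinates generate the maximal ideal *)

(** The Pluecker coordinate of a reflection, with the sign that makes it restrict
    to the matrix entry X. *)
Definition box_fn b : R :=
  (-1) ^+ sval (cid (minor_coset le_dn (refl_of b))) *
  plucker (enum_rank (coset_Idn le_dn (refl_of b))).

Lemma restricts_sign (e : bool) z phi : restricts_to z phi ->
  restricts_to ((-1) ^+ e * z) (fun X => (-1) ^+ e * phi X).
Proof.
apply: restrictsM.
by rewrite -(rmorph_sign (proj_const P)); exact: restricts_const.
Qed.

Lemma restricts_box b : restricts_to (box_fn b) (fun X => X (col b) (row b)).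
Proof.
rewrite /box_fn; case: cid => e /= he.
apply: restricts_ext (restricts_sign e (restricts_plucker _)) => X.
by rewrite wedgeE enum_rankK he signrMK minor_refl.
Qed.

Definition box_coord b : A := to_lr (box_fn b).

Local Notation m := (@max_ideal K N (schubert K w) P).
Local Notation affine := (affine lr_const box_coord m).

Lemma box_coord_max b : m (box_coord b).
Proof.
exists (box_fn b); split=> //; have [k [f [hf vf ef]]] := restricts_box b.
exists k, f, ('X_i0 ^+ k); split=> //; first exact: homogXn.
- by rewrite rmorphXn /= mevalXU Pi0 expr1n oner_neq0.
- by have := ef m0; rewrite -id_pointE => <-.
Qed.

(** The generic matrix X of the chart, with entries in the local ring of the
    projective space; 0 is a default value off the boxes. *)
Definition box_matrix (j k : 'I_n) : R := if insub (j, k) is Some b then box_fn b else 0.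

Lemma box_matrixE (t : 'I_d) (k : 'I_n) : (d <= k)%N ->
  exists b, [/\ box_matrix (W t) k = box_fn b, col b = W t & row b = k].
Proof.
move=> dk; have bP : ((W t, k).1 < d <= (W t, k).2)%N by rewrite /= ltn_ord.
by exists (Sub (W t, k) bP); rewrite /box_matrix insubT /bcol /brow SubK.
Qed.

Lemma restricts_chart k t :
  restricts_to (chart le_dn 1 box_matrix k t) (fun X => chart le_dn 1 X k t).
Proof.
apply: (@restricts_ext _ (fun X => if (k < d)%N then (k == W t)%:R else X (W t) k)).
  by move=> X; rewrite chart1E.
rewrite chart1E; case: ltnP => dk.
  by case: eqP => _; [exact: restricts1 | exact: restricts0].
by have [b [-> <- <-]] := box_matrixE t dk; exact: restricts_box.
Qed.

Lemma chart_affine k t : affine (to_lr (chart le_dn 1 box_matrix k t)) (chart le_dn 1 m0 k t).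
Proof.
rewrite !chart1E; case: ltnP => dk.
  by rewrite rmorph_nat -(rmorph_nat lr_const); exact: affine_const.
by have [b [-> _ _]] := box_matrixE t dk; exact: affine_gen.
Qed.

(** Both sides restrict to the same function of X. *)
Lemma plucker_minor i :
  to_lr (plucker i) = \det (\matrix_(s, t) to_lr (chart le_dn 1 box_matrix (tnth (val (enum_val i)) s) t)).
Proof.
set f := tnth _.
have -> : \det (\matrix_(s, t) to_lr (chart le_dn 1 box_matrix (f s) t)) =
    to_lr (minor f (chart le_dn 1 box_matrix)).
  by rewrite -det_map_mx; congr (\det _); apply/matrixP => s t; rewrite !mxE.
apply/eqP; rewrite -subr_eq0 -rmorphB; apply/eqP.
apply: (@restricts_vanish _ (fun X => pt X 0 i - pt X 0 i)); last by move=> X _; rewrite subrr.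
apply: restrictsD (restricts_plucker i) (restrictsN _).
apply: (@restricts_ext _ (fun X => \det (\matrix_(s, t) chart le_dn 1 X (f s) t))).
  by move=> X; rewrite wedgeE.
by apply: restricts_det => s t; rewrite mxE; exact: restricts_chart.
Qed.

Lemma plucker_affine i : affine (to_lr (plucker i)) (P 0 i).
Proof.
have -> : P 0 i = minor (tnth (val (enum_val i))) (chart le_dn 1 m0) by rewrite id_pointE wedgeE.
rewrite plucker_minor; apply: affine_det => [|s t]; first exact: box_coord_max.
rewrite mxE [X in affine _ X]mxE; exact: chart_affine.
Qed.

Lemma form_affine (z : R) k f : f \is k.-homog -> val z = f%:F / ('X_i0 ^+ k)%:F ->
  affine (to_lr z) f.@[P 0].
Proof.
move=> hf vz.
have -> : z = \sum_(a <- msupp f) proj_const P f@_a * \prod_i plucker i ^+ a i.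
  apply: val_inj; rewrite vz {1}[f]mpolyE !rmorph_sum mulr_suml.
  rewrite !big_seq; apply: eq_bigr => a /(dhomog_mf hf) da; rewrite /= in da.
  rewrite [RHS]rmorphM [in RHS]rmorph_prod -mul_mpolyC [in LHS]rmorphM -mulrA.
  congr (_ * _); rewrite mpolyXE_id [in LHS]rmorph_prod -da mdegE expr_sum.
  rewrite [X in _ / X]rmorph_prod -prodf_div.
  by apply: eq_bigr => i _; rewrite [RHS]rmorphXn !rmorphXn -expr_div_n.
rewrite mevalE rmorph_sum /=; apply: affine_sum => a _.
have bm := box_coord_max; rewrite rmorphM rmorph_prod; apply: (affineM bm).
  exact: affine_const.
apply: affine_prod => // i _; rewrite rmorphXn /=; apply: affineX => //.
exact: plucker_affine.
Qed.

(** Write f / g as (f / p_id^k) times the inverse of g / p_id^k. *)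
Lemma lr_affine (z : R) k f g : f \is k.-homog -> g \is k.-homog -> g.@[P 0] != 0 ->
  val z = f%:F / g%:F -> affine (to_lr z) (f.@[P 0] / g.@[P 0]).
Proof.
move=> hf hg g0 vz.
have quo (h h' : {mpoly K[N]}) : h \is k.-homog -> h' \is k.-homog -> h'.@[P 0] != 0 ->
    exists z : R, val z = h%:F / h'%:F.
  move=> hh hh' h'0; have rz : regular_at P (h%:F / h'%:F) by apply/asboolP; exists k, h, h'.
  by exists (exist _ (h%:F / h'%:F) rz).
have X0 : ('X_i0 ^+ k : {mpoly K[N]}).@[P 0] != 0.
  by rewrite rmorphXn /= mevalXU Pi0 expr1n oner_neq0.
have [zf vf] := quo f _ hf (homogXn k) X0.
have [zg vg] := quo g _ hg (homogXn k) X0.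
have [zi vi] := quo _ g (homogXn k) hg g0.
have -> : z = zf * zi.
  apply: val_inj; rewrite rmorphM /= vz vf vi mulrA divfK // tofrac_eq0.
  exact: Xn_neq0.
rewrite rmorphM; apply: affineM; [exact: box_coord_max|exact: form_affine vf|].
apply: (@affineV _ _ _ _ _ _ _ (to_lr zg)) => //.
- exact: box_coord_max.
- rewrite -rmorphM -(rmorph1 to_lr); congr (to_lr _); apply: val_inj.
  rewrite rmorphM /= vg vi mulrA divfK; last by rewrite tofrac_eq0; exact: Xn_neq0.
  by rewrite divff // tofrac_eq0; exact: meval_neq0 g0.
- exact: form_affine vg.
Qed.

Lemma span_ideal_pow k (x : A) : ideal_pow m k x -> graded lr_const box_coord m k x.
Proof.
apply: graded_ideal_pow; first exact: box_coord_max.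
- move=> y; rewrite -[y]reprK; have /asboolP[l [f [g [hf hg g0 v]]]] := valP (repr y).
  by exists (f.@[P 0] / g.@[P 0]); exact: lr_affine hf hg g0 v.
- move=> _ [z [-> [l [f [g [hf hg g0 f0 v]]]]]].
  by have := lr_affine hf hg g0 v; rewrite f0 mul0r.
Qed.

Lemma box_minor_vanish q C : sorted (@box_lt n d) C -> all (in_rect 1 q) C ->
  (count_below W q < size C + count_below (tnth (val w)) q)%N ->
  \det (\matrix_(k, l) box_coord (mix (tnth (in_tuple C) k) (tnth (in_tuple C) l))) = 0.
Proof.
move=> sC aC big; pose c k := tnth (in_tuple C) k.
have -> : \det (\matrix_(k, l) box_coord (mix (c k) (c l))) =
    to_lr (\det (\matrix_(k, l) box_fn (mix (c k) (c l)))).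
  by rewrite -det_map_mx; congr (\det _); apply/matrixP => s t; rewrite !mxE.
apply: (@restricts_vanish _ (fun X => \det (\matrix_(k, l) X (col (c k)) (row (c l))))).
  apply: restricts_det => k l; rewrite mxE.
  by have := restricts_box (mix (c k) (c l)); rewrite col_mix row_mix.
by move=> X cX; exact: chain_minor_eq0 sC aC big cX.
Qed.

(** * Order of vanishing on lines through the identity point *)

Section Curve.
Variable X : 'I_n -> 'I_n -> K.
Hypothesis n_gt0 : (0 < n)%N.
Hypothesis cellX : in_cell (tnth (val w)) (chart le_dn 1 X).

Definition scale_pt (t : K) (j k : 'I_n) : K := t * X j k.

(** Restriction of forms to the line t |-> [1; t X], as polynomials in t. *)
Definition curve : {mpoly K[N]} -> {poly K} :=
  mmap (@polyC K) (fun i => minor (tnth (val (enum_val i)))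
                              (chart le_dn 1 (fun j k => 'X * (X j k)%:P))).

Lemma curve_horner f t : (curve f).[t] = f.@[pt (scale_pt t) 0].
Proof.
rewrite /curve /mmap mevalE horner_sum; apply: eq_bigr => a _.
rewrite hornerM hornerC horner_prod; congr (_ * _); apply: eq_bigr => i _.
rewrite horner_exp wedgeE; congr (_ ^+ _).
rewrite /minor -[LHS]/(horner_eval t (\det _)) -det_map_mx; congr (\det _).
apply/matrixP => r s; rewrite mxE [RHS]mxE /= /horner_eval [X in X.[t]]mxE !chart1E.
by case: ifP => _; rewrite ?hornerMn ?hornerC // hornerM hornerX hornerC.
Qed.

(** Multiplying the rows below the identity block by t is the action of a diagonal
    matrix, so cells are cones in this chart. *)
Lemma scale_cell t : t != 0 -> in_cell (tnth (val w)) (chart le_dn 1 (scale_pt t)).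
Proof.
move=> t0; pose D : 'M[K]_n := diag_mx (\row_i if (i < d)%N then 1 else t).
have -> : chart le_dn 1 (scale_pt t) = D *m chart le_dn 1 X *m 1%:M.
  rewrite mulmx1 mul_diag_mx; apply/matrixP => k j; rewrite [RHS]mxE [X in X * _]mxE !chart1E.
  by case: ifP => _; rewrite ?mul1r.
apply: in_cell_mul cellX; last exact: unitmx1.
split=> [i j ji|i]; rewrite !mxE; last by rewrite eqxx; case: ifP => _; rewrite ?oner_neq0.
by case: eqP => // e; rewrite e ltnn in ji.
Qed.

Lemma scale_schubert t : t != 0 -> schubert K w (pt (scale_pt t)).
Proof.
move=> t0; split; last first.
  by move=> k f hf; apply; apply: cell_orbit => //; exact: scale_cell.
apply: contraTneq (oner_neq0 K) => e; have := pt_id le_dn (scale_pt t).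
by rewrite e mxE => <-; rewrite eqxx.
Qed.

Lemma curve0 f : (curve f).[0] = f.@[P 0].
Proof.
rewrite curve_horner id_pointE; apply: meval_eq => i; congr (pt _ 0 i).
by apply/funext => j; apply/funext => k; rewrite /scale_pt mul0r.
Qed.

Definition vanish_order k (z : R) : Prop :=
  exists f g, [/\ g.@[P 0] != 0, val z = f%:F / g%:F & 'X^k %| curve f].

Lemma curveM f g : curve (f * g) = curve f * curve g.
Proof. exact: rmorphM. Qed.

Lemma vanish_orderD k z z' : vanish_order k z -> vanish_order k z' -> vanish_order k (z + z').
Proof.
move=> [f [g [g0 vz df]]] [f' [g' [g'0 vz' df']]].
exists (f * g' + f' * g), (g * g'); split.
- by rewrite mevalM mulf_neq0.
- by rewrite rmorphD /= vz vz' addf_div ?tofrac_eq0 ?(meval_neq0 g0) ?(meval_neq0 g'0) //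
     tofracD !tofracM.
- have -> : curve (f * g' + f' * g) = curve f * curve g' + curve f' * curve g.
    by rewrite -!curveM; exact: mmapD.
  by apply: dvdp_add; exact: dvdp_mulr.
Qed.

Lemma vanish_orderM k l z z' : vanish_order k z -> vanish_order l z' ->
  vanish_order (k + l) (z * z').
Proof.
move=> [f [g [g0 vz df]]] [f' [g' [g'0 vz' df']]].
exists (f * f'), (g * g'); split.
- by rewrite mevalM mulf_neq0.
- by rewrite rmorphM /= vz vz' mulf_div !tofracM.
- by rewrite curveM exprD dvdp_mul.
Qed.

Lemma vanish_order0 z : vanish_order 0 z.
Proof.
have /asboolP[l [f [g [hf hg g0 v]]]] := valP z.
by exists f, g; split=> //; rewrite expr0 dvd1p.
Qed.

Lemma vanish_order_zero k : vanish_order k 0.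
Proof.
exists 0, 1; split; rewrite ?meval1 ?oner_neq0 //; first by rewrite tofrac0 mul0r.
by rewrite /curve mmap0 dvdp0.
Qed.

Lemma vanish_order_local_ideal k z : z \in @local_ideal K N (schubert K w) P -> vanish_order k z.
Proof.
move=> /asboolP[l [f [g [hf hg g0 van v]]]]; exists f, g; split=> //.
rewrite (poly_closed_eq0 (q := curve f)) ?dvdp0 // => t t0.
by rewrite curve_horner; apply/van/scale_schubert.
Qed.

Lemma ideal_pow_vanish k (x : A) : ideal_pow m k x ->
  exists2 z, x = to_lr z & vanish_order k z.
Proof.
elim/ideal_pow_ind => [|x1 x2 [z1 -> h1] [z2 -> h2]|a f mf].
- by exists 0; [rewrite rmorph0 | exact: vanish_order_zero].
- by exists (z1 + z2); [rewrite rmorphD | exact: vanish_orderD].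
have [z ze hz] : exists2 z, \prod_j f j = to_lr z & vanish_order k z.
  elim: k f mf => [|k IHk] f mf.
    by exists 1; [rewrite big_ord0 rmorph1 | exact: vanish_order0].
  rewrite big_ord_recl; have [|z -> hz] := IHk (fun j => f (lift ord0 j)); first by move=> j.
  have [y [-> [l [g [h [hg hh h0 g0 vy]]]]]] := mf ord0.
  exists (y * z); first by rewrite rmorphM.
  rewrite -add1n; apply: vanish_orderM hz; exists g, h; split=> //.
  by rewrite expr1 -[X in X %| _]subr0 -polyC0 dvdp_XsubCl rootE curve0 g0.
exists (repr a * z); first by rewrite rmorphM ze -[in LHS](reprK a).
by rewrite -[k]add0n; apply: vanish_orderM hz; exact: vanish_order0.
Qed.

(** The numerator of z restricts to s t^k on the line, while membership in the next
    power of the maximal ideal makes it divisible by t^(k+1). *)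
Lemma leading_form_eq0 k z phi s : restricts_to z phi -> ideal_pow m k.+1 (to_lr z) ->
  (forall t, phi (scale_pt t) = t ^+ k * s) -> s = 0.
Proof.
move=> [l [F [hF vz ev]]] /ideal_pow_vanish[z' /to_lr_eq zz' oz'] hom.
have [f [g [g0 vf df]]] : vanish_order k.+1 z.
  by rewrite -[z](subrK z'); apply: vanish_orderD oz'; exact: vanish_order_local_ideal.
have eq : F * g = f * 'X_i0 ^+ l.
  apply/eqP; rewrite -tofrac_eq !tofracM -eqr_div ?tofrac_eq0 ?(meval_neq0 g0) ?Xn_neq0 //.
  by rewrite -vz vf.
have dF : 'X^(k.+1) %| curve F.
  have : 'X^(k.+1) %| curve F * curve g by rewrite -curveM eq curveM dvdp_mulr.
  rewrite Gauss_dvdpl // coprimep_expl // coprimep_sym -['X]subr0 -polyC0.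
  by rewrite coprimep_XsubC rootE curve0.
have FE : curve F = s *: 'X^k.
  apply/eqP; rewrite -subr_eq0; apply/eqP/poly_closed_eq0 => t _.
  by rewrite hornerD hornerN hornerZ hornerXn curve_horner -ev hom mulrC subrr.
have /dvdpP[q qE] := dF; have := congr1 (fun p : {poly K} => p`_k) qE.
by rewrite FE coefMXn ltnSn coefZ coefXn eqxx mulr1.
Qed.

End Curve.

(** * The basis of the graded ring *)

Section Basis.
Variable r : nat.
Local Notation Swr := (Sw le_dn w r).

Definition Sw_nth (i : 'I_#|` Swr|) : multiset (proot n d) := nth mset0 (enum_fset Swr) i.

Definition Sw_basis (i : 'I_#|` Swr|) : A := mono box_coord (Sw_nth i).

Lemma Sw_nthP i : in_Sw le_dn w (Sw_nth i) /\ size (Sw_nth i) = r.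
Proof. by apply/SwP; rewrite /Sw_nth -/(_ \in enum_fset _) mem_nth. Qed.

Lemma Sw_nth_inj : injective Sw_nth.
Proof.
by move=> i j /eqP; rewrite nth_uniq ?fset_uniq // => /eqP/val_inj.
Qed.

Lemma span_Sw_basis y : lin_span lr_const (admissible_monos le_dn (tnth (val w)) box_coord r) y ->
  exists c : 'rV[K]_#|` Swr|, y = \sum_i c 0 i *: Sw_basis i.
Proof.
elim=> [|c g z [S [sS gS ->]] _ [c' ->]].
  by exists 0; rewrite big1 // => i _; rewrite mxE scale0r.
have : seq_mset S \in Swr.
  apply/SwP; split; last by rewrite (perm_size (perm_eq_seq_mset S)).
  by apply/in_Sw_admissible => q C sC aC; apply: gS sC _; apply: sub_all aC => b; rewrite mset_seqE.
move=> /(nthP mset0)[i lti ei].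
exists (c *: delta_mx 0 (Ordinal lti) + c').
have -> : mono box_coord S = Sw_basis (Ordinal lti).
  by rewrite /Sw_basis /Sw_nth ei; apply: perm_big; rewrite perm_sym perm_eq_seq_mset.
under [RHS]eq_bigr => j _ do rewrite mxE scalerDl.
rewrite big_split /=; congr (_ + _); rewrite (bigD1 (Ordinal lti)) //= big1 => [|j ne].
  by rewrite addr0 !mxE !eqxx mulr1 lr_scaleE.
by rewrite !mxE eqxx (negbTE ne) mulr0 scale0r.
Qed.

Lemma prod_count (F : proot n d -> K) (S : seq (proot n d)) :
  \prod_(b <- S) F b = \prod_b F b ^+ count_mem b S.
Proof.
elim: S => [|a S IHS]; first by rewrite big_nil big1.
rewrite big_cons IHS [RHS](bigD1 a) //= (bigD1 a) //= eqxx add1n exprS mulrA.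
by congr (_ * _); apply: eq_bigr => b ne; rewrite eq_sym (negbTE ne).
Qed.

Lemma Sw_basis_free (n_gt0 : (0 < n)%N) (a : 'I_#|` Swr| -> K) :
  ideal_pow m r.+1 (\sum_i a i *: Sw_basis i) -> forall i, a i = 0.
Proof.
move=> Ia i.
apply: (@monomials_independent n d le_dn K 1 (tnth (val w)) _ xpredT
          (fun i b => Sw_nth i b) a) => //.
- by move=> j k jk _; rewrite !perm1.
- exact: tnth_Idn_inj.
- by move=> j _; apply/in_Sw_admissible; have [] := Sw_nthP j.
- move=> j k _ _ h; apply: Sw_nth_inj; apply/msetP => b; apply: h.
  by have [bd db] := box_bounds b; rewrite /in_shape !perm1; apply: leq_trans db.
move=> X cX.
have shapeT b : in_shape 1 b by have [bd db] := box_bounds b; rewrite /in_shape !perm1; apply: leq_trans db.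
pose z : R := \sum_j proj_const P (a j) * \prod_(b <- Sw_nth j) box_fn b.
pose phi (Y : 'I_n -> 'I_n -> K) := \sum_j a j * \prod_(b <- Sw_nth j) Y (col b) (row b).
have rz : restricts_to z phi.
  apply: restricts_sum => j _; apply: restrictsM; first exact: restricts_const.
  by apply: restricts_prod => b _; exact: restricts_box.
have -> : \sum_(j | true) a j * \prod_(b | in_shape 1 b) X (col b) (row b) ^+ Sw_nth j b = phi X.
  apply: eq_bigr => j _; rewrite prod_count; congr (_ * _).
  by apply: eq_big => [b|b _]; rewrite ?shapeT // count_mem_mset.
apply: (leading_form_eq0 n_gt0 cX rz (k := r)).
  have -> : to_lr z = \sum_j a j *: Sw_basis j.
    by rewrite rmorph_sum; apply: eq_bigr => j _; rewrite rmorphM rmorph_prod lr_scaleE.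
  exact: Ia.
move=> t; rewrite /phi mulr_sumr; apply: eq_bigr => j _; rewrite mulrCA; congr (_ * _).
rewrite big_split /= big_const_seq; congr (_ * _).
by rewrite count_predT (proj2 (Sw_nthP j)) iter_mulr_1.
Qed.

Lemma hilbert_Sw : (0 < n)%N -> hilbert_tangent_cone (schubert K w) P r #|` Swr|.
Proof.
move=> n_gt0; exists Sw_basis; split=> [i|v Iv].
  rewrite -[X in ideal_pow _ X](proj2 (Sw_nthP i)).
  by apply: monos_ideal; [exact: box_coord_max | exists (Sw_nth i)].
have [y sy hy] := span_ideal_pow Iv.
have [c yE] : exists c : 'rV[K]_#|` Swr|, y = \sum_i c 0 i *: Sw_basis i.
  apply: span_Sw_basis; apply: span_bind sy => _ [S <- ->].
  by apply: straighten; exact: box_minor_vanish.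
exists c; split; first by rewrite -yE.
move=> c' hc'; apply/rowP => i; apply/eqP; rewrite -subr_eq0; apply/eqP.
apply: (Sw_basis_free n_gt0 (a := fun i => c 0 i - c' 0 i)).
under eq_bigr => j _ do rewrite scalerBl.
rewrite sumrB -yE; have -> : y - \sum_j c' 0 j *: Sw_basis j =
  (v - \sum_j c' 0 j *: Sw_basis j) + - (v - y) by rewrite opprB [RHS]addrC addrA subrK.
by apply: ideal_powD => //; exact: ideal_powN.
Qed.

End Basis.
End LocalRing.

Theorem theorem1 (K : closedFieldType) (n d : nat)
    (d_gt0 : (0 < d)%N) (d_lt_n : (d < n)%N) (w : Idn n d) (m : nat) :
  hilbert_tangent_cone (schubert K w) (id_point K (ltnW d_lt_n)) m
    #|` Sw (ltnW d_lt_n) w m |.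
Proof. by apply: hilbert_Sw; apply: leq_ltn_trans d_lt_n. Qed.
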